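(* Let $0=t_0<t_1<\cdots<t_N=T$ with $N\ge 1$. Suppose that a state reduction $\big(\{\mathbb{X}_{t_i}\}_{0\le i\le N},\{\theta_{t_i}\}_{0\le i\le N},\{f_{t_i:t_{i+1}}\}_{0\le i\le N-1}\big)$ exists across the consecutive time blocks $\{t_i,\dots,t_{i+1}\}$, $i=0,\dots,N-1$, which is compatible with the stochastic kernels $\{\rho_{s-1:s}\}_{1\le s\le T}$. Suppose that there exists a nonnegative lower semianalytic function $\tilde\jmath:\mathbb{X}_T\to[0,+\infty]$ such that the cost function $j:\mathbb{H}_T\to[0,+\infty]$ factors as $j=\tilde\jmath\circ\theta_T$. Define functions $\tilde V_{t_i}:\mathbb{X}_{t_i}\to[0,+\infty]$, $i=0,\dots,N$, by $$\tilde V_{t_N}=\tilde\jmath,\qquad \tilde V_{t_i}=\widetilde{\mathcal B}_{t_{i+1}:t_i}\tilde V_{t_{i+1}},\quad i=0,\dots,N-1 .$$ Then the value functions $V_{t_i}:\mathbb{H}_{t_i}\to[0,+\infty]$ satisfy $$V_{t_i}=\tilde V_{t_i}\circ\theta_{t_i}\qquad\text{for all } i=0,\dots,N .$$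
   Context: Setting. $T\ge1$ is an integer. Borel space: a Borel subset of a Polish space (up to homeomorphism) with its Borel $\sigma$-field. $\Delta(\mathbb Y)$ is the Borel space of probability measures on a Borel space $\mathbb Y$. A function $\varphi:\mathbb{X}\to[0,+\infty]$ on a Borel space is lower semianalytic if $\{\varphi<c\}$ is an analytic set for every $c\in\mathbb{R}$; $L^0_+(\mathbb{X})$ denotes the set of such functions. A map between Borel spaces is universally measurable if preimages of Borel sets belong to the universal $\sigma$-field (the intersection of the completions of the Borel $\sigma$-field under all Borel probability measures). Integrals of universally measurable functions are taken with respect to completed measures; $\inf\emptyset=+\infty$. Histories. $\mathbb{U}_t$ ($0\le t\le T-1$) and $\mathbb{W}_t$ ($0\le t\le T$) are Borel spaces (controls, uncertainties). $\mathbb{H}_t=\mathbb{W}_0\times\prod_{s=1}^t(\mathbb{U}_{s-1}\times\mathbb{W}_s)$, with elements $h_t=(w_0,u_0,w_1,\dots,u_{t-1},w_t)$; $\mathbb{H}_{r:s}=\prod_{\tau=r}^s(\mathbb{U}_{\tau-1}\times\mathbb{W}_\tau)$ with elements $h_{r:s}=(u_{r-1},w_r,\dots,u_{s-1},w_s)$, so $h_t=(h_{r},h_{r+1:t})$. For $1\le t\le T$, $\rho_{t-1:t}:\mathbb{H}_{t-1}\to\Delta(\mathbb{W}_t)$ is a Borel-measurable stochastic kernel, written $\rho_{t-1:t}(dw_t\mid h_{t-1})$. $\Gamma_{t:T-1}$ is the set of sequences $\gamma=(\gamma_s)_{t\le s\le T-1}$ of universally measurable maps $\gamma_s:\mathbb{H}_s\to\mathbb{U}_s$.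 For $\gamma\in\Gamma_{t:T-1}$ and $h_t\in\mathbb{H}_t$, $\rho^\gamma_{t:T}(\cdot\mid h_t)\in\Delta(\mathbb{H}_T)$ is the law of the history $h_T$ obtained from $h_t$ by $u_s=\gamma_s(h_s)$, $w_{s+1}\sim\rho_{s:s+1}(\cdot\mid h_s)$, $h_{s+1}=(h_s,u_s,w_{s+1})$, $s=t,\dots,T-1$. Value functions. $j:\mathbb{H}_T\to[0,+\infty]$ is lower semianalytic; $V_T=j$ and, for $0\le t\le T-1$, $V_t(h_t)=\inf_{\gamma\in\Gamma_{t:T-1}}\int_{\mathbb{H}_T}j(h'_T)\,\rho^\gamma_{t:T}(dh'_T\mid h_t)$. State reduction. The family $\big(\{\mathbb{X}_{t_i}\},\{\theta_{t_i}\},\{f_{t_i:t_{i+1}}\}\big)$ consists of Borel spaces $\mathbb{X}_{t_i}$, Borel-measurable maps $\theta_{t_i}:\mathbb{H}_{t_i}\to\mathbb{X}_{t_i}$, and Borel-measurable maps $f_{t_i:t_{i+1}}:\mathbb{X}_{t_i}\times\mathbb{H}_{t_i+1:t_{i+1}}\to\mathbb{X}_{t_{i+1}}$. It is a state reduction across the consecutive time blocks if, for all $i=0,\dots,N-1$ and all $h_{t_{i+1}}=(h_{t_i},h_{t_i+1:t_{i+1}})\in\mathbb{H}_{t_{i+1}}$, $\theta_{t_{i+1}}(h_{t_{i+1}})=f_{t_i:t_{i+1}}(\theta_{t_i}(h_{t_i}),h_{t_i+1:t_{i+1}})$. It is compatible with the kernels if for every $i=0,\dots,N-1$ there are Borel-measurable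 reduced kernels $\tilde\rho_{t_i:t_i+1}:\mathbb{X}_{t_i}\to\Delta(\mathbb{W}_{t_i+1})$ and $\tilde\rho_{s-1:s}:\mathbb{X}_{t_i}\times\mathbb{H}_{t_i+1:s-1}\to\Delta(\mathbb{W}_s)$ for $t_i+2\le s\le t_{i+1}$, with $\rho_{t_i:t_i+1}(dw\mid h_{t_i})=\tilde\rho_{t_i:t_i+1}(dw\mid\theta_{t_i}(h_{t_i}))$ and $\rho_{s-1:s}(dw\mid (h_{t_i},h_{t_i+1:s-1}))=\tilde\rho_{s-1:s}(dw\mid\theta_{t_i}(h_{t_i}),h_{t_i+1:s-1})$ for all histories. Reduced Bellman operators. For $\tilde\varphi\in L^0_+(\mathbb{X}_{t_{i+1}})$ and $x\in\mathbb{X}_{t_i}$, writing $r=t_i$, $t=t_{i+1}$, the operator is the nested sequence of infima of integrals $$(\widetilde{\mathcal B}_{t:r}\tilde\varphi)(x)=\inf_{u_r\in\mathbb{U}_r}\int_{\mathbb{W}_{r+1}}\tilde\rho_{r:r+1}(dw_{r+1}\mid x)\ \inf_{u_{r+1}\in\mathbb{U}_{r+1}}\int_{\mathbb{W}_{r+2}}\tilde\rho_{r+1:r+2}(dw_{r+2}\mid x,u_r,w_{r+1})\cdots\inf_{u_{t-1}\in\mathbb{U}_{t-1}}\int_{\mathbb{W}_t}\tilde\rho_{t-1:t}(dw_t\mid x,u_r,w_{r+1},\dots,u_{t-2},w_{t-1})\ \tilde\varphi\big(f_{r:t}(x,u_r,w_{r+1},\dots,u_{t-1},w_t)\big).$$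 *)

(* Defs.v *)
From HB Require Import structures.
From mathcomp Require Import all_boot all_order all_algebra.
From mathcomp Require Import all_classical all_reals all_analysis.
From mathcomp Require Import measurable_realfun.

Set Implicit Arguments.
Unset Strict Implicit.
Unset Printing Implicit Defensive.
Import Order.TTheory GRing.Theory Num.Theory.

Local Open Scope classical_set_scope.
Local Open Scope ring_scope.

Section borel.
Context (R : realType).

Definition polish_space (P : completePseudoMetricType R) : Prop :=
  hausdorff_space P /\ exists2 D : set P, countable D & dense D.

(* Through [e], T is identified with a Borel subset of the Polish space P, and
   its sigma-algebra is the trace of the Borel sets of P.  As measurable types
   are pointed, Borel spaces are nonempty here. *)
Definition borel_space d (T : measurableType d) : Prop :=
  exists (P : completePseudoMetricType R) (e : T -> P),
    [/\ polish_space P, injective e, <<s [set O : set P | open O] >> (range e)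
      & (measurable : set (set T)) =
        [set e @^-1` B | B in <<s [set O : set P | open O] >>]].

(* Analytic sets of a Borel space: images of Borel subsets of Borel spaces under
   Borel maps. *)
Definition analytic_set d (T : measurableType d) (A : set T) : Prop :=
  exists d' (Y : measurableType d') (f : Y -> T) (B : set Y),
    [/\ borel_space Y, measurable_fun [set: Y] f, measurable B & A = f @` B].

Definition lower_semianalytic d (T : measurableType d) (phi : T -> \bar R) :
    Prop :=
  (forall x, 0 <= phi x)%E /\
  forall c : R, analytic_set [set x | (phi x < c%:E)%E].

(* [completed_algebra_gen p] consists of the unions of a measurable set and a
   p-negligible set, i.e. it is the completion of the sigma-algebra of T
   under p. *)
Definition universally_measurable d (T : measurableType d) (A : set T) : Prop :=
  forall p : probability T R, completed_algebra_gen p A.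

Record univ_mfun d d' (T : measurableType d) (T' : measurableType d') :=
  UnivMFun {
    univ_mfun_val :> T -> T' ;
    univ_mfunP : forall B, measurable B ->
      universally_measurable (univ_mfun_val @^-1` B) }.

(* Integral with respect to the completion of mu: the integrand is a function on
   the type of Caratheodory measurable sets of the outer measure of mu, which is
   convertible to T. *)
Definition integral_completed d (T : measurableType d)
    (mu : {measure set T -> \bar R}) (f : T -> \bar R) : \bar R :=
  (\int[@completed_measure_extension _ _ _ mu]_x f x)%E.

End borel.

Arguments univ_mfun R {d d'} T T'.

(* If h has law P, u = g h and w has conditional law rho h, then [step_law] is
   the law of (h, (u, w)).  As g is only universally measurable, the integrand
   below is measurable for the completed sigma-algebra only. *)
Section step_law.
Context (R : realType) (dH dU dW : measure_display) (H : measurableType dH)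
  (U : measurableType dU) (W : measurableType dW) (rho : R.-pker H ~> W)
  (g : univ_mfun R H U) (P : probability H R).
Local Open Scope ereal_scope.

Definition step_law (A : set (H * (U * W))) : \bar R :=
  integral_completed P (fun h => rho h [set w | A (h, (g h, w))]).

Let I := caratheodory_type (P^*)%mu.

Let borel_sub_completed (A : set H) :
  measurable A -> measurable (A : set I).
Proof. by move=> mA; apply: sub_caratheodory; exact: sub_sigma_algebra. Qed.

Let univ_sub_completed (A : set H) :
  universally_measurable R A -> measurable (A : set I).
Proof.
move=> /(_ P)[B mB [N [C [mC PC0 NC]]] <-].
apply: measurableU; first exact: borel_sub_completed.
apply: measure_is_complete_caratheodory; exists (C : set I); split => //.
- exact: borel_sub_completed.
- by rewrite -PC0; exact: measurable_mu_extE.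
Qed.

Let rhoI (h : I) : {measure set W -> \bar R} := rho h.

Let measurable_rhoI B : measurable B -> measurable_fun [set: I] (rhoI ^~ B).
Proof.
move=> mB _ Y mY; rewrite setTI; apply: borel_sub_completed.
by rewrite -[X in measurable X]setTI; exact: measurable_kernel.
Qed.

HB.instance Definition _ := isKernel.Build _ _ I W R rhoI measurable_rhoI.

Let rhoI1 h : rhoI h [set: W] = 1.
Proof. exact: prob_kernel. Qed.

HB.instance Definition _ := Kernel_isProbability.Build _ _ I W R rhoI rhoI1.

Let append (hw : I * W) : H * (U * W) := (hw.1, (g hw.1, hw.2)).

Let measurable_append : measurable_fun [set: I * W] append.
Proof.
apply: (measurable_fun_pair (f := fun hw : I * W => hw.1 : H) (g := fun hw : I * W => (g hw.1, hw.2))).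
  apply: (@measurableT_comp _ _ _ _ _ _ (fun h : I => h : H)) => //.
  by move=> _ Y mY; rewrite setTI; exact: borel_sub_completed.
apply: measurable_fun_pair; last exact: measurable_snd.
apply: (@measurableT_comp _ _ _ _ _ _ (g : I -> U)) => //.
by move=> _ Y mY; rewrite setTI; apply: univ_sub_completed; exact: univ_mfunP.
Qed.

Let section_append A h :
  xsection (append @^-1` A) h = [set w | A (h, (g h, w))].
Proof. by rewrite xsectionE. Qed.

Let measurable_section A h : measurable A ->
  measurable ([set w | A (h, (g h, w))] : set W).
Proof.
move=> mA; rewrite -section_append; apply: measurable_xsection.
by rewrite -[X in measurable X]setTI; exact: measurable_append.
Qed.

Let measurable_step (A : set (H * (U * W))) : measurable A ->
  measurable_fun [set: I] (fun h : I => rho h [set w | A (h, (g h, w))]).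
Proof.
move=> mA; under eq_fun do rewrite -section_append.
apply: (@measurable_fun_xsection_finite_kernel _ _ I W R rhoI).
by rewrite inE -[X in measurable X]setTI; exact: measurable_append.
Qed.

Let step_law0 : step_law set0 = 0.
Proof.
rewrite /step_law /integral_completed; apply: integral0_eq => h _.
exact: measure0.
Qed.

Let step_law_ge0 A : 0 <= step_law A.
Proof. by apply: integral_ge0 => h _; exact: measure_ge0. Qed.

Let step_law_sigma_additive : semi_sigma_additive step_law.
Proof.
move=> F mF tF mUF; rewrite [X in _ --> X](_ : _ =
    \sum_(n <oo) step_law (F n)).
  by apply: is_cvg_nneseries => n _ _; exact: step_law_ge0.
rewrite /step_law /integral_completed -integral_nneseries//; last first.
  by move=> n; exact: measurable_step.
apply: eq_integral => h _; apply/esym/cvg_lim => //.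
have -> : [set w | (\bigcup_n F n) (h, (g h, w))] =
          \bigcup_n [set w | F n (h, (g h, w))] by [].
apply: measure_sigma_additive; first by move=> n; exact: measurable_section.
move/trivIsetP : tF => tF; apply/trivIsetP => i j _ _ ij.
by have /seteqP[sub _] := tF i j Logic.I Logic.I ij; apply/seteqP; split => w //= [? ?];
  apply: (sub (h, (g h, w))).
Qed.

HB.instance Definition _ := isMeasure.Build _ _ _ step_law
  step_law0 step_law_ge0 step_law_sigma_additive.

Let step_law1 : step_law [set: _] = 1.
Proof.
rewrite /step_law /integral_completed.
under eq_integral do rewrite [X in rho _ X](_ : _ = setT)// prob_kernel.
rewrite integral_cst// mul1e.
by rewrite -[RHS](@probability_setT _ _ _ P); exact: measurable_mu_extE.
Qed.

HB.instance Definition _ :=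
  Measure_isProbability.Build _ _ _ step_law step_law1.

Definition step_prob : probability (H * (U * W))%type R := step_law.

End step_law.

(* All families are indexed by the whole of nat; the components beyond the
   horizon play no role (they can be chosen freely, all types being pointed). *)
Section histories.
Context (dU dW : nat -> measure_display)
  (U : forall t, measurableType (dU t)) (W : forall t, measurableType (dW t)).

Fixpoint hist_disp (t : nat) : measure_display :=
  if t is t'.+1 then
    ((hist_disp t'), ((dU t'), (dW t'.+1)).-prod).-prod%mdisp
  else dW 0.

Fixpoint hist (t : nat) : measurableType (hist_disp t) :=
  if t is t'.+1 then (hist t' * (U t' * W t'.+1))%type else W 0.

(* [steps r n] is the space of (u_r, w_(r+1), ..., u_(r+n-1), w_(r+n)); it is the
   one-point space for n = 0.  Times are written n + r rather than r + n so that
   [hist (n.+1 + r)] is convertible to [hist (n + r) * (U (n + r) * W (n + r).+1)]. *)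
Fixpoint steps_disp (r n : nat) : measure_display :=
  if n is n'.+1 then
    ((steps_disp r n'), ((dU (n' + r)), (dW (n' + r).+1)).-prod).-prod%mdisp
  else default_measure_display.

Fixpoint steps (r n : nat) : measurableType (steps_disp r n) :=
  if n is n'.+1 then (steps r n' * (U (n' + r) * W (n' + r).+1))%type
  else unit.

Definition hist_cast s t (e : s = t) (h : hist s) : hist t :=
  ecast n (hist n) e h.

Fixpoint hist_cat r n : hist r -> steps r n -> hist (n + r) :=
  if n is n'.+1 return hist r -> steps r n -> hist (n + r)
  then fun h b => (@hist_cat r n' h b.1, b.2)
  else fun h _ => h.

End histories.

Section value_functions.
Context (R : realType) (dU dW : nat -> measure_display)
  (U : forall t, measurableType (dU t)) (W : forall t, measurableType (dW t))
  (rho : forall s, R.-pker (hist U W s) ~> W s.+1).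

(* A policy provides a control map at every time; [history_law] from t to T only
   uses those at times t, ..., T - 1, so that ranging over policies or over their
   restrictions to these times is the same. *)
Definition policy := forall s, univ_mfun R (hist U W s) (U s).

Fixpoint law_after (g : policy) t (h : hist U W t) n :
    probability (hist U W (n + t)) R :=
  if n is n'.+1 return probability (hist U W (n + t)) R
  then step_prob (rho (n' + t)) (g (n' + t)%N) (law_after g h n')
  else @dirac _ _ h R.

Definition history_law (g : policy) t T (le_tT : (t <= T)%N)
    (h : hist U W t) : probability (hist U W T) R :=
  ecast s (probability (hist U W s) R) (subnK le_tT) (law_after g h (T - t)).

Definition value T (j : hist U W T -> \bar R) t (le_tT : (t <= T)%N)
    (h : hist U W t) : \bar R :=
  match @eqP _ t T with
  | ReflectT e => j (hist_cast e h)
  | ReflectF _ => ereal_inf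
      [set integral_completed (history_law g le_tT h) j | g in [set: policy]]
  end.

End value_functions.

Section bellman.
Context (R : realType) (dU dW : nat -> measure_display)
  (U : forall t, measurableType (dU t)) (W : forall t, measurableType (dW t))
  (r : nat) (d : measure_display) (X : measurableType d)
  (rhot : forall k, R.-pker (X * steps U W r k) ~> W (k + r).+1).

(* y = (x, (u_r, w_(r+1), ..., w_(r+k))) *)
Definition bellman_step k (psi : X * steps U W r k.+1 -> \bar R)
    (y : X * steps U W r k) : \bar R :=
  ereal_inf [set integral_completed (rhot k y)
                   (fun w => psi (y.1, (y.2, (u, w))))
            | u in [set: U (k + r)%N]].

Fixpoint bellman_iter n : (X * steps U W r n -> \bar R) -> X -> \bar R :=
  if n is n'.+1 return (X * steps U W r n -> \bar R) -> X -> \bar R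
  then fun psi => bellman_iter (bellman_step psi)
  else fun psi x => psi (x, tt).

Definition reduced_bellman t d' (X' : measurableType d')
    (f : X * steps U W r (t - r) -> X') (phi : X' -> \bar R) : X -> \bar R :=
  bellman_iter (phi \o f).

End bellman.

Section reduction.
Context (R : realType) (dU dW dX : nat -> measure_display)
  (U : forall t, measurableType (dU t)) (W : forall t, measurableType (dW t))
  (N : nat) (t_ : nat -> nat) (X : forall i, measurableType (dX i))
  (theta : forall i, hist U W (t_ i) -> X i)
  (f : forall i, X i * steps U W (t_ i) (t_ i.+1 - t_ i) -> X i.+1).

(* (h_s, h_(s+1:t)) seen as an element of the space of histories up to t *)
Definition block_cat s t (le_st : (s <= t)%N) (h : hist U W s)
    (b : steps U W s (t - s)) : hist U W t :=
  hist_cast (subnK le_st) (hist_cat h b).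

Definition is_state_reduction : Prop :=
  [/\ forall i, (i <= N)%N -> measurable_fun [set: _] (@theta i),
      forall i, (i < N)%N -> measurable_fun [set: _] (@f i)
    & forall i, (i < N)%N -> forall (le_t : (t_ i <= t_ i.+1)%N) h b,
        @theta i.+1 (block_cat le_t h b) = f (theta h, b)].

Definition compatible (rho : forall s, R.-pker (hist U W s) ~> W s.+1)
    (rhot : forall i k, R.-pker (X i * steps U W (t_ i) k) ~> W (k + t_ i).+1) :
    Prop :=
  forall i, (i < N)%N -> forall k, (k < t_ i.+1 - t_ i)%N ->
  forall (h : hist U W (t_ i)) (b : steps U W (t_ i) k) (A : set _),
    measurable A -> rho (k + t_ i)%N (hist_cat h b) A = rhot i k (theta h, b) A.

End reduction.

(* Main.v *)
Require Import Defs.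
From HB Require Import structures.
From mathcomp Require Import all_boot all_order all_algebra.
From mathcomp Require Import all_classical all_reals all_analysis.
From mathcomp Require Import measurable_realfun.

(* The value functions satisfy V_t(h) = inf_u \int V_(t+1)(h, (u, w)) rho(dw | h);
   iterating this over one block and using the compatibility of the kernels gives
   the reduced Bellman operator.

   The measurable selection behind the one-step equation is handled by replacing
   analytic sets by projections of measurable sets along the Baire space, to which
   every Borel space reduces by a measurable surjection from the Baire space.
   A function phi >= 0 whose strict sublevel sets are such projections has a jointly
   measurable family of majorants G(., n), n in the Baire space, such that for every
   probability P some G(., n) equals phi P-almost everywhere: writing {phi < r} as
   the result of a Souslin operation, G is built from the sets of points having a
   branch z <= n + c for some constant c, which are measurable by Koenig's lemma.
   This makes the class stable under integration with respect to kernels.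

   Since the cost is computed from a fixed initial history, an almost everywhere
   epsilon-optimal control is enough at each step, and it can be taken Borel. *)

Set Implicit Arguments.
Unset Strict Implicit.
Unset Printing Implicit Defensive.
Import Order.TTheory GRing.Theory Num.Theory.

Local Open Scope classical_set_scope.
Local Open Scope ring_scope.

(** * The Souslin operation *)

(** The bijection sending (k, l) to 2^k (2l + 1) - 1. It increases in l, so the first [npair k l]
    entries of a branch determine the first l entries of its row k. *)
Definition npair (k l : nat) : nat := (2 ^ k * l.*2.+1).-1.
Definition nunpair (m : nat) : nat * nat :=
  let k := logn 2 m.+1 in (k, ((m.+1 %/ 2 ^ k)./2)%N).

Lemma npairK k l : nunpair (npair k l) = (k, l).
Proof.
rewrite /nunpair /npair prednK ?muln_gt0 ?expn_gt0//.
have -> : logn 2 (2 ^ k * l.*2.+1) = k.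
  rewrite lognM ?expn_gt0// pfactorK// (lognE 2 l.*2.+1) /= dvdn2 /= odd_double /=.
  by rewrite addn0.
by rewrite mulKn ?expn_gt0// -[l.*2.+1]/(1 + l.*2)%N (half_bit_double l true).
Qed.

Lemma leq_npair k l : (l <= npair k l)%N.
Proof.
rewrite /npair -ltnS prednK ?muln_gt0 ?expn_gt0//.
apply: leq_trans (leq_pmull _ _); last by rewrite expn_gt0.
by rewrite ltnS -addnn leq_addr.
Qed.

Lemma npair_mono k l l' : (l < l')%N -> (npair k l < npair k l')%N.
Proof.
move=> ll'; rewrite /npair -ltnS !prednK ?muln_gt0 ?expn_gt0//.
by rewrite ltn_pmul2l ?expn_gt0// ltnS ltn_double.
Qed.

(** Row k of a sequence read as an infinite table through [npair]; one branch can thus carry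
    countably many. *)
Definition brow (k : nat) (z : nat -> nat) : nat -> nat := fun l => z (npair k l).
Definition bmerge (w : nat -> nat -> nat) : nat -> nat :=
  fun m => w (nunpair m).1 (nunpair m).2.

Lemma brow_bmerge w k : brow k (bmerge w) = w k.
Proof. by apply/funext => l; rewrite /brow /bmerge npairK. Qed.

Lemma eq_mkseqP (z z' : nat -> nat) k :
  mkseq z k = mkseq z' k <-> (forall i, (i < k)%N -> z i = z' i).
Proof.
split=> [e i ik|e]; first by rewrite -(nth_mkseq 0%N z ik) e nth_mkseq.
by apply/eq_in_map => i; rewrite mem_iota /= => /e.
Qed.

Section souslin.
Context {X : Type}.
Implicit Types (C : set (set X)) (A : set X).

Definition souslin C A := exists2 B : seq nat -> set X,
  forall s, C (B s) & A = [set x | exists z, forall k, B (mkseq z k) x].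

(* Condition [k] is checked at a level [npair k b] that is large enough for the
   prefix of the branch to determine it. *)
Lemma souslin_flex C (B : nat -> (nat -> nat) -> set X) (m : nat -> nat) :
  C setT -> (forall k z, C (B k z)) ->
  (forall k z z', mkseq z (m k) = mkseq z' (m k) -> B k z = B k z') ->
  exists2 B' : seq nat -> set X, forall s, C (B' s) &
    forall x z, (forall k, B' (mkseq z k) x) <-> (forall k, B k z x).
Proof.
move=> CT CB Bm.
pose B' (s : seq nat) := let k := (nunpair (size s)).1 in
  if (m k <= size s)%N then B k (nth 0%N s) else setT.
exists B' => [s|x z]; first by rewrite /B'; case: ifP.
split=> [H k|H k].
  have := H (npair k (m k)); rewrite /B' size_mkseq npairK /= leq_npair.
  rewrite (Bm _ _ z)//; apply/eq_mkseqP => i ik; rewrite nth_mkseq//.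
  exact: leq_trans ik (leq_npair _ _).
rewrite /B' size_mkseq; case: ifP => // mk.
rewrite (Bm _ _ z)//; apply/eq_mkseqP => i ik; rewrite nth_mkseq//.
exact: leq_trans ik mk.
Qed.

Lemma souslin_self C A : C A -> souslin C A.
Proof.
move=> CA; exists (fun=> A) => //; apply/seteqP; split=> [x Ax|x [z]].
  by exists (fun=> 0%N).
by apply; exact: 0%N.
Qed.

(** Row 0 of the new branch is the outer branch, and row k + 1 is the inner branch witnessing the
    condition at outer level k. Condition q decodes to a pair of levels (k, l). *)
Lemma souslin_idem C A : C setT -> souslin (souslin C) A -> souslin C A.
Proof.
move=> CT [B CB ->].
have /choice[D HD] : forall s, exists D : seq nat -> set X, (forall t, C (D t)) /\
    B s = [set x | exists z, forall k, D (mkseq z k) x].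
  by move=> s; have [D ? ?] := CB s; exists D.
pose E q z := D (mkseq (brow 0 z) (nunpair q).1) (mkseq (brow (nunpair q).1.+1 z) (nunpair q).2).
(* A depth at which both prefixes read by condition q are known. *)
pose m q := (npair 0 (nunpair q).1 + npair (nunpair q).1.+1 (nunpair q).2)%N.
have [|||B' CB' HB'] := @souslin_flex C E m.
- exact: CT.
- by move=> k z; have [+ _] := HD (mkseq (brow 0 z) (nunpair k).1); exact.
- move=> q z z' /eq_mkseqP e; rewrite /E.
  have -> : mkseq (brow 0 z) (nunpair q).1 = mkseq (brow 0 z') (nunpair q).1.
    apply/eq_mkseqP => i ik; apply: e; apply: leq_trans (leq_addr _ _).
    exact: npair_mono.
  congr (D _ _ ); apply/eq_mkseqP => i ik; apply: e.
  by apply: leq_trans (leq_addl _ _); exact: npair_mono.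
exists B' => //; apply/seteqP; split => [x [z Hz]|x [z Hz]].
  have /choice[w Hw] : forall k, exists w, forall l, D (mkseq z k) (mkseq w l) x.
    by move=> k; have := Hz k; have [_ ->] := HD (mkseq z k).
  exists (bmerge (fun n => if n is n'.+1 then w n' else z)).
  by apply/HB' => q; rewrite /E !brow_bmerge; exact: Hw.
exists (brow 0 z) => k; have [_ ->] := HD (mkseq (brow 0 z) k).
exists (brow k.+1 z) => l.
by have /HB'/(_ (npair k l)) := Hz; rewrite /E npairK.
Qed.

Lemma souslin_bigcap C (F : nat -> set X) : C setT ->
  (forall n, souslin C (F n)) -> souslin C (\bigcap_n F n).
Proof.
(* The scheme ignores the branch: level k imposes [F k]. *)
move=> CT CF; apply: souslin_idem => //; exists (fun s => F (size s)) => //.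
apply/seteqP; split=> [x Fx|x [z Hz] k _].
  by exists id => k; rewrite size_mkseq; exact: Fx.
by have := Hz k; rewrite size_mkseq.
Qed.

Lemma souslin_bigcup C (F : nat -> set X) : C setT ->
  (forall n, souslin C (F n)) -> souslin C (\bigcup_n F n).
Proof.
move=> CT CF; apply: souslin_idem => //.
(* The first entry of the branch chooses the index in the union, so the empty prefix imposes
   nothing. *)
exists (fun s => if s is a :: _ then F a else setT).
  by case=> [|? ?] //; exact: souslin_self.
apply/seteqP; split=> [x [n _ Fx]|x [z Hz]].
  by exists (fun=> n) => -[|k].
by exists (z 0%N) => //; have := Hz 1%N.
Qed.

(** Souslin sets are stable under countable unions and intersections but in general not under
    complements, so the induction runs on the sets that are Souslin along with their complement. *)
Lemma souslin_sigma C G : C setT -> C set0 ->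
  (forall A, G A -> souslin C A /\ souslin C (~` A)) ->
  forall A, <<s G >> A -> souslin C A.
Proof.
move=> CT C0 GC A sA.
suff [] : [set A | souslin C A /\ souslin C (~` A)] A by [].
apply: sA; split; last by move=> ? /GC.
split.
- by split; [|rewrite setC0]; exact: souslin_self.
- by move=> B [? ?]; rewrite setTD; split; rewrite ?setCK.
- move=> F SF; split; first by apply: souslin_bigcup => // n; have [] := SF n.
  by rewrite setC_bigcup; apply: souslin_bigcap => // n; have [] := SF n.
Qed.
End souslin.

(** * The Baire space *)

Section countable_quantifiers.
Context d (T : measurableType d).

Lemma measurable_exists (I : countType) (F : I -> set T) :
  (forall i, measurable (F i)) -> measurable [set x | exists i, F i x].
Proof.
move=> mF; rewrite (_ : [set _ | _] =
    \bigcup_n (if unpickle n is Some i then F i else set0)).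
  by apply: bigcup_measurable => n _; case: unpickle.
apply/seteqP; split=> [x [i Fx]|x [n _]].
  by exists (pickle i); rewrite ?pickleK.
by case: unpickle => // i Fx; exists i.
Qed.

Lemma measurable_forall (I : countType) (F : I -> set T) :
  (forall i, measurable (F i)) -> measurable [set x | forall i, F i x].
Proof.
move=> mF; rewrite (_ : [set _ | _] = ~` [set x | exists i, (~` F i) x]).
  by apply: measurableC; apply: measurable_exists => i; exact: measurableC.
apply/seteqP; split=> x /= => [Fx [i]//|nF i].
by apply: contrapT => nFi; apply: nF; exists i.
Qed.

Lemma measurable_imp (P : Prop) (F : set T) :
  (P -> measurable F) -> measurable [set x | P -> F x].
Proof.
move=> mF; have [p|np] := pselect P.
  rewrite (_ : [set _ | _] = F); first exact: mF.
  by apply/seteqP; split=> x /=; [apply|].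
rewrite (_ : [set _ | _] = setT)//.
by apply/seteqP; split=> x //= _ /np.
Qed.

Lemma measurable_andp (P : Prop) (F : set T) :
  (P -> measurable F) -> measurable [set x | P /\ F x].
Proof.
move=> mF; have [p|np] := pselect P.
  rewrite (_ : [set _ | _] = F); first exact: mF.
  by apply/seteqP; split=> x /= => [[]|].
rewrite (_ : [set _ | _] = set0)//.
by apply/seteqP; split=> x //= [/np].
Qed.

Lemma measurable_preimage d' (T' : measurableType d') (f : T -> T') (A : set T') :
  measurable_fun setT f -> measurable A -> measurable (f @^-1` A).
Proof. by move=> mf mA; rewrite -[X in measurable X]setTI; exact: mf. Qed.

End countable_quantifiers.

Lemma measurable_fun_nat d (T : measurableType d) (f : T -> nat) :
  (forall a, measurable [set x | f x = a]) -> measurable_fun setT f.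
Proof.
move=> mf _ Y _; rewrite setTI.
rewrite (_ : _ @^-1` _ = [set x | exists a, Y a /\ f x = a]).
  by apply: measurable_exists => a; apply: measurable_andp => _; exact: mf.
by apply/seteqP; split=> x /= => [Yx|[a [Ya ->]]//]; exists (f x).
Qed.

Definition cylinders : set (set (nat -> nat)) :=
  [set A | exists i a, A = [set z | z i = a]].
(** The coordinates generate the Borel sets of the product topology. *)
Definition baire := g_sigma_algebraType cylinders.
HB.instance Definition _ := Measurable.on baire.

Lemma measurable_coord i : measurable_fun [set: baire] (fun z : baire => z i : nat).
Proof.
by apply: measurable_fun_nat => a; apply: sub_sigma_algebra; exists i, a.
Qed.

Lemma measurable_to_baire d (T : measurableType d) (f : T -> baire) :
  (forall i, measurable_fun setT (fun x => f x i : nat)) -> measurable_fun setT f.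
Proof.
move=> mf; apply: (@measurability _ _ _ baire setT f cylinders) => //.
move=> _ [_ [i [a ->]] <-].
by have := mf i measurableT [set a] I.
Qed.

Lemma measurable_brow k : measurable_fun [set: baire] (brow k : baire -> baire).
Proof. by apply: measurable_to_baire => i; exact: measurable_coord. Qed.

Lemma measurable_mkseq_eq d (T : measurableType d) (f : T -> nat -> nat) n s :
  (forall i, (i < n)%N -> measurable_fun setT (fun x => f x i : nat)) ->
  measurable [set x | mkseq (f x) n = s].
Proof.
move=> mf; rewrite (_ : [set _ | _] = [set x | size s = n /\
    forall i, (i < n)%N -> f x i = nth 0%N s i]).
  apply: measurable_andp => _; apply: measurable_forall => i.
  apply: measurable_imp => i_n.
  by apply: (measurable_preimage (mf _ i_n) (_ : measurable [set _])).
apply/seteqP; split=> x /= => [<-|[sn H]].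
  by rewrite size_mkseq; split=> // i i_n; rewrite nth_mkseq.
apply: (@eq_from_nth _ 0%N); rewrite size_mkseq// => i i_n.
by rewrite nth_mkseq//; exact: H.
Qed.

(** * Measurable subsets of a product with the Baire space *)

Section finitely_determined.
Context d (X : measurableType d).

(** Sets whose section at y depends only on a prefix of y of one fixed length [m]; fixing the length
    gives complements the same form. *)
Definition fin_det : set (set (X * baire)) := [set E | exists m,
  exists2 M : seq nat -> set X, (forall s, measurable (M s)) &
    E = [set p | M (mkseq p.2 m) p.1]].

Lemma fin_detC E : fin_det E -> fin_det (~` E).
Proof.
move=> [m [M mM ->]]; exists m, (fun s => ~` M s) => // s.
exact: measurableC.
Qed.

Lemma fin_det_fst A : measurable A -> fin_det (fst @^-1` A).
Proof. by move=> mA; exists 0%N, (fun=> A). Qed.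

Lemma fin_det_coord i a : fin_det [set p | p.2 i = a].
Proof.
exists i.+1, (fun s => if nth 0%N s i == a then setT else set0) => [s|].
  by case: ifP.
apply/seteqP; split=> -[x y] /=; rewrite nth_mkseq//; last by case: eqP.
by move=> ->; rewrite eqxx.
Qed.

(** The product sigma-algebra is generated by preimages under the two projections. Those under the
    first are finitely determined; those under the second are Souslin, with their complements, by
    induction from the cylinders. *)
Lemma souslin_measurable (E : set (X * baire)) :
  measurable E -> souslin fin_det E.
Proof.
have CT : fin_det setT by rewrite -(preimage_setT fst); exact: fin_det_fst.
have C0 : fin_det set0 by rewrite -setCT; exact: fin_detC.
have sC A : measurable A -> souslin fin_det (snd @^-1` A).
  pose S := [set A : set baire | souslin fin_det (snd @^-1` A) /\
                                 souslin fin_det (snd @^-1` (~` A))].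
  move=> mA; suff [] : S A by [].
  apply: (mA S); split; last first.
    move=> _ [i [a ->]]; split; apply: souslin_self; first exact: fin_det_coord.
    by rewrite -preimage_setC; apply: fin_detC; exact: fin_det_coord.
  split.
  - by split; rewrite ?setC0 ?preimage_setT ?preimage_set0; exact: souslin_self.
  - by move=> B [? ?]; rewrite setTD; split; rewrite ?setCK.
  - move=> F SF; split.
      by rewrite preimage_bigcup; apply: souslin_bigcup => // n; have [] := SF n.
    rewrite setC_bigcup preimage_bigcap.
    by apply: souslin_bigcap => // n; have [] := SF n.
apply: souslin_sigma => // A [[B mB <-]|[B mB <-]]; rewrite setTI preimage_setC.
  split; apply: souslin_self; apply: fin_det_fst; first exact: mB.
  by apply: measurableC; exact: mB.
split; apply: sC; first exact: mB.
by apply: measurableC; exact: mB.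
Qed.

(** Row 0 of z is the point y and row 1 a branch of the Souslin scheme of [E]. Forgetting y presents
    the projection of [E] as a Souslin operation on measurable sets of [X]. *)
Lemma measurable_scheme (E : set (X * baire)) : measurable E ->
  exists2 B : seq nat -> set X, forall s, measurable (B s) &
    forall x y, E (x, y) <->
      exists z, brow 0 z = y /\ forall k, B (mkseq z k) x.
Proof.
move=> /souslin_measurable[Q CQ EQ].
have /choice[m /choice[M HM]] : forall s, exists m,
    exists M : seq nat -> set X, (forall s, measurable (M s)) /\
    Q s = [set p | M (mkseq p.2 m) p.1].
  by move=> s; have [m [M ? ?]] := CQ s; exists m, M.
(* The length of the prefix of y read by a set of the scheme varies with that set; the second half
   of q guesses it, and a wrong guess imposes nothing. *)
pose B q z := if m (mkseq (brow 1 z) (nunpair q).1) == (nunpair q).2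
  then M (mkseq (brow 1 z) (nunpair q).1) (mkseq (brow 0 z) (nunpair q).2) else setT.
pose n q := (npair 1 (nunpair q).1 + npair 0 (nunpair q).2)%N.
have [|||B' CB' HB'] := @souslin_flex X measurable B n.
- exact: measurableT.
- by move=> k z; rewrite /B; case: ifP => // _; have [] := HM (mkseq (brow 1 z) (nunpair k).1).
- move=> q z z' /eq_mkseqP e; rewrite /B.
  have -> : mkseq (brow 1 z) (nunpair q).1 = mkseq (brow 1 z') (nunpair q).1.
    apply/eq_mkseqP => i ik; apply: e; apply: leq_trans (leq_addr _ _).
    exact: npair_mono.
  suff -> : mkseq (brow 0 z) (nunpair q).2 = mkseq (brow 0 z') (nunpair q).2 by [].
  apply/eq_mkseqP => i ik; apply: e.
  by apply: leq_trans (leq_addl _ _); exact: npair_mono.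
exists B' => // x y; rewrite EQ /=; split=> [[z Hz]|[z [zy /HB' Hz]]].
  exists (bmerge (fun n => if n is 0%N then y else z)); rewrite brow_bmerge; split=> //.
  apply/HB' => q; rewrite /B !brow_bmerge; case: eqP => // <-.
  by have := Hz (nunpair q).1; have [_ ->] := HM (mkseq z (nunpair q).1).
exists (brow 1 z) => k; have [_ ->] := HM (mkseq (brow 1 z) k); rewrite /= -zy.
by have := Hz (npair k (m (mkseq (brow 1 z) k))); rewrite /B npairK /= eqxx.
Qed.

End finitely_determined.

(** * Souslin schemes up to null sets *)

Lemma take_mkseq (z : nat -> nat) i k : (i <= k)%N -> take i (mkseq z k) = mkseq z i.
Proof. by move=> ik; rewrite /mkseq -map_take take_iota (minn_idPl ik). Qed.

Fixpoint branch_prefix (a : seq nat -> nat) (k : nat) : seq nat :=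
  if k is k'.+1 then rcons (branch_prefix a k') (a (branch_prefix a k')) else [::].
Definition branch (a : seq nat -> nat) : nat -> nat := fun k => a (branch_prefix a k).

Lemma mkseq_branch a k : mkseq (branch a) k = branch_prefix a k.
Proof. by elim: k => //= k IH; rewrite mkseqS IH. Qed.

(** Koenig's lemma: entry i takes at most [n i + 1] values, so a prefix with admissible extensions
    of all lengths has a one-entry extension of the same kind. *)
Lemma konig (n : nat -> nat) (Q : seq nat -> Prop) :
  (forall k, exists s, [/\ size s = k, forall i, (i < k)%N -> (nth 0%N s i <= n i)%N
     & forall i, (i <= k)%N -> Q (take i s)]) ->
  exists z, (forall i, (z i <= n i)%N) /\ forall k, Q (mkseq z k).
Proof.
move=> H.
pose good t := forall k, exists s, [/\ size s = (size t + k)%N,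
  forall i, (i < size s)%N -> (nth 0%N s i <= n i)%N,
  forall i, (i <= size s)%N -> Q (take i s) & take (size t) s = t].
have good0 : good [::].
  move=> k; have [s [sk sn sQ]] := H k; exists s.
  by split; rewrite ?take0// ?sk.
have goodS t : good t -> exists a, good (rcons t a).
  move=> gt; apply: contrapT => /forallNP nex.
  have /choice[K HK] a := (existsNP _).2 (nex a).
  (* [M] bounds the lengths at which the finitely many one-entry extensions fail. An admissible
     extension longer than that contradicts the failure for its own next entry. *)
  pose M := (\max_(a < (n (size t)).+1) K a)%N.
  have [s [ss sn sQ st]] := gt M.+1.
  pose a := nth 0%N s (size t).
  have ts : (size t < size s)%N by rewrite ss addnS ltnS leq_addr.
  have an : (a < (n (size t)).+1)%N by rewrite ltnS; exact: sn.
  have KM : (K a <= M)%N by exact: (leq_bigmax (Ordinal an)).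
  have le : (size t + (K a).+1 <= size s)%N by rewrite ss leq_add2l ltnS.
  apply: (HK a); exists (take (size t + (K a).+1) s).
  have -> : size (take (size t + (K a).+1) s) = (size t + (K a).+1)%N.
    by apply: size_takel.
  split.
  - by rewrite size_rcons addnS addSn.
  - move=> i i_lt; rewrite nth_take//; apply: sn.
    exact: leq_trans le.
  - by move=> i il; rewrite take_takel//; apply: sQ; exact: leq_trans le.
  - rewrite size_rcons take_takel; last by rewrite addnS ltnS leq_addr.
    by rewrite (take_nth 0%N)// st.
have /choice[a Ha] t : exists a, good t -> good (rcons t a).
  have [/goodS[a ?]|ng] := pselect (good t); first by exists a.
  by exists 0%N.
have gb k : good (branch_prefix a k) by elim: k => //= k /Ha.
have sb k : size (branch_prefix a k) = k by elim: k => //= k IH; rewrite size_rcons IH.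
have gs t : good t -> (forall i, (i < size t)%N -> (nth 0%N t i <= n i)%N) /\ Q t.
  move=> /(_ 0%N)[s []]; rewrite addn0 => ss sn sQ; rewrite -ss take_size => <-.
  by split=> //; rewrite -(take_size s); exact: sQ.
exists (branch a); split=> [i|k]; last first.
  by rewrite mkseq_branch; have [] := gs _ (gb k).
have [+ _] := gs _ (gb i.+1); rewrite sb => /(_ _ (ltnSn i)).
by rewrite /= nth_rcons sb ltnn eqxx.
Qed.

(** The constant [c] depends on the point. It absorbs finitely many violations of z <= n, so
    domination from some rank on is enough. *)
Definition bounded_branch (X : Type) (B : seq nat -> set X) : set (X * baire) :=
  [set p | exists c z, (forall i, (z i <= p.2 i + c)%N) /\
                       forall k, B (mkseq z k) p.1].

Section almost_everywhere.
Context d (X : measurableType d).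

(** Koenig's lemma trades the quantifier over branches for one over finite sequences of each length,
    which leaves countable operations only. *)
Lemma measurable_bounded_branch (B : seq nat -> set X) :
  (forall s, measurable (B s)) -> measurable (bounded_branch B).
Proof.
move=> mB; rewrite (_ : bounded_branch B = [set p | exists c, forall k,
    exists s, size s = k /\ forall i, (i < k.+1)%N ->
      ([set p : X * baire | (i < k)%N -> (nth 0%N s i <= p.2 i + c)%N] `&`
      [set p | B (take i s) p.1]) p]).
  apply: measurable_exists => c; apply: measurable_forall => k.
  apply: measurable_exists => s; apply: measurable_andp => _.
  apply: measurable_forall => i; apply: measurable_imp => _.
  apply: measurableI.
    apply: measurable_imp => _.
    apply: (measurable_preimage (measurableT_comp (measurable_coord i) measurable_snd)
      (_ : measurable [set m : nat | (nth 0 s i <= m + c)%N])) => //.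
  exact: (measurable_preimage measurable_fst (mB _)).
apply/seteqP; split=> -[x n] /= [c].
  move=> [z [zn zB]]; exists c => k; exists (mkseq z k); rewrite size_mkseq; split=> // i.
  rewrite ltnS => ik; split.
    by move=> /= lik; rewrite nth_mkseq//.
  by rewrite /= take_mkseq.
move=> H; exists c; apply: (@konig (fun i => n i + c)%N (fun s => B s x)) => k.
have [s [sk Hs]] := H k; exists s; split=> // i ik.
  by have [] := Hs _ (leqW ik); move=> H0 _; exact: H0.
by have [] := Hs i ik.
Qed.

Context (R : realType) (P : probability X R).
Local Open Scope ereal_scope.

Lemma ae_countable (I : countType) (Q : I -> X -> Prop) :
  (forall i, \forall x \ae P, Q i x) -> \forall x \ae P, forall i, Q i x.
Proof.
move=> HQ.
have : \forall x \ae P, forall n, if unpickle n is Some i then Q i x else True.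
  by apply/ae_foralln => n; case: unpickle => [i|]; [exact: HQ|exact: aeW].
by apply: filterS => x H i; have := H (pickle i); rewrite pickleK.
Qed.

Lemma ae_notin (N : set X) : measurable N -> P N = 0 -> \forall x \ae P, ~ N x.
Proof. by move=> mN N0; exists N; split => // x /= /contrapT. Qed.

(** The infimum of the measures of measurable supersets is attained by intersecting a minimizing
    sequence; intersecting further with a superset [M] cannot lower the measure, so nothing of
    positive measure lies outside [M]. *)
Lemma measurable_hull (A : set X) : exists H, [/\ measurable H, A `<=` H &
  forall M, measurable M -> A `<=` M -> P (H `\` M) = 0].
Proof.
pose S := [set P M | M in [set M | measurable M /\ A `<=` M]].
have S1 x : S x -> 0 <= x <= 1.
  by move=> [M [mM _] <-]; rewrite measure_ge0 probability_le1.
have m0 : 0 <= ereal_inf S by apply: le_ereal_inf_tmp => x /S1/andP[].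
have m1 : ereal_inf S <= 1.
  by apply: ereal_inf_lbound; exists setT; [split|exact: probability_setT].
have mf : ereal_inf S \is a fin_num.
  by rewrite ge0_fin_numE//; apply: le_lt_trans m1 _; rewrite ltry.
have /choice[M HM] n : exists M, [/\ measurable M, A `<=` M &
    P M < ereal_inf S + (n.+1%:R^-1)%:E].
  have e0 : (0 < n.+1%:R^-1 :> R)%R by rewrite invr_gt0.
  have [x [M [mM AM] <-] lt] := lb_ereal_inf_adherent e0 mf.
  by exists M.
exists (\bigcap_n M n).
have mH : measurable (\bigcap_n M n).
  by apply: bigcapT_measurable => n; have [] := HM n.
split=> //; first by move=> x Ax n _; have [_ + _] := HM n; exact.
move=> N mN AN.
have PH : P (\bigcap_n M n) <= ereal_inf S.
  apply/lee_addgt0Pr => e e0.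
  have [n ne] : exists n, (n.+1%:R^-1 < e)%R.
    by near \oo => n; exists n; near: n; exact: near_infty_natSinv_lt (PosNum e0).
  have [mM _ lt] := HM n.
  apply: le_trans (_ : P (M n) <= _).
    by apply: le_measure; rewrite ?inE// => x; exact.
  by rewrite (le_trans (ltW lt))// leeD2l// lee_fin ltW.
have := measureDI P mH mN => E.
have PN : ereal_inf S <= P (\bigcap_n M n `&` N).
  apply: ereal_inf_lbound; exists (\bigcap_n M n `&` N) => //; split.
    exact: measurableI.
  by move=> x Ax; split; [move=> n _; have [_ + _] := HM n; exact|exact: AN].
have fN : P (\bigcap_n M n `&` N) \is a fin_num.
  by apply: fin_num_measure; exact: measurableI.
apply/eqP; rewrite eq_le measure_ge0 andbT.
rewrite -(leeD2rE _ _ fN) add0e -E.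
exact: le_trans PN.
Unshelve. all: by end_near. Qed.

(* Let [H t] be a measurable hull, inside [B t], of the set of points having a
   branch through [t].  The points of [H t] lying in no [H (rcons t a)] form a null
   set by minimality, so almost every point of [H [::]] has a leftmost branch. *)
Lemma ae_selection (B : seq nat -> set X) : (forall s, measurable (B s)) ->
  exists2 f : X -> baire, measurable_fun setT f & \forall x \ae P,
    (exists z, forall k, B (mkseq z k) x) -> forall k, B (mkseq (f x) k) x.
Proof.
move=> mB.
pose A t := [set x | exists z, mkseq z (size t) = t /\ forall k, B (mkseq z k) x].
have /choice[H0 HH0] t : exists H, [/\ measurable H, A t `<=` H &
  forall M, measurable M -> A t `<=` M -> P (H `\` M) = 0] by exact: measurable_hull.
have mH0 t : measurable (H0 t) by have [] := HH0 t.
pose H t := H0 t `&` B t.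
have mH t : measurable (H t) by exact: measurableI.
have AH t : A t `<=` H t.
  move=> x [z [zt zB]]; split; first by have [_ + _] := HH0 t; apply; exists z.
  by rewrite -zt; exact: zB.
pose next t x := [set a | H (rcons t a) x].
have aeN : \forall x \ae P, forall t, H t x -> next t x !=set0.
  apply: ae_countable => t.
  pose M := [set x | exists a, H (rcons t a) x].
  have mM : measurable M by apply: measurable_exists.
  exists (H0 t `\` M); split => //; first exact: measurableD.
    have [_ _] := HH0 t; apply => // x [z [zt zB]].
    exists (z (size t)); apply: AH; exists z; rewrite size_rcons mkseqS zt.
    by split.
  move=> x /= /not_implyP[[H0x Bx] Nx]; split=> // -[a Ha].
pose least t x : nat := xget 0%N
  [set a | next t x a /\ forall b, next t x b -> (a <= b)%N].
have leastP t x : next t x !=set0 -> next t x (least t x).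
  move=> [a na].
  have [] // : [set a | next t x a /\ forall b, next t x b -> (a <= b)%N] (least t x).
  rewrite /least.
  have ex : exists a, `[< next t x a >] by exists a; apply/asboolP.
  apply: (@xgetPex _ 0%N [set a | next t x a /\ forall b, next t x b -> (a <= b)%N]).
  exists (ex_minn ex); case: ex_minnP => m /asboolP nm mmin.
  by split=> // b nb; apply: mmin; apply/asboolP.
have mleast t : measurable_fun setT (least t).
  apply: measurable_fun_nat => a.
  (* The second set collects the points without continuation, where [least] takes its default value
     0. *)
  have -> : [set x | least t x = a] =
     [set x | (next t x a /\ forall b, (b < a)%N -> ~ next t x b)] `|`
     ([set x | a = 0%N /\ forall b, ~ next t x b]).
    apply/seteqP; split=> x /=.
      rewrite /least; case: xgetP => /= [m -> [nm mmin] <-|nex <-].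
        left; split=> // b bm nb.
        by have := mmin _ nb; rewrite leqNgt bm.
      right; split=> // b nb; have := leastP t x (ex_intro _ b nb) => nl.
      have ex : exists a, `[< next t x a >] by exists b; apply/asboolP.
      apply: (nex (ex_minn ex)); case: ex_minnP => m /asboolP nm mmin.
      by split=> // c nc; apply: mmin; apply/asboolP.
    move=> [[na nb]|[-> nb]].
      rewrite /least; case: xgetP => /= [m _ [nm mmin]|nex].
        have ma := mmin _ na.
        by apply/eqP; rewrite eqn_leq ma leqNgt; apply/negP => /nb.
      exfalso; apply: (nex a); split=> // b nxb.
      by rewrite leqNgt; apply/negP => /nb.
    by rewrite /least; case: xgetP => //= m _ [/nb].
  apply: measurableU.
    apply: measurableI; first exact: mH.
    apply: (@measurable_forall _ X nat (fun b x => (b < a)%N -> (~` H (rcons t b)) x)) => b.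
    by apply: measurable_imp => _; exact: measurableC.
  apply: measurable_andp => _.
  apply: (@measurable_forall _ X nat (fun b => ~` H (rcons t b))) => b.
  exact: measurableC.
pose f x := branch (least ^~ x).
have mpre k : forall t, measurable [set x | branch_prefix (least ^~ x) k = t].
  elim: k => [|k IH] t.
    rewrite (_ : [set _ | _] = if t == [::] then setT else set0); first by case: ifP.
    by apply/seteqP; split=> x /=; case: t.
  rewrite (_ : [set _ | _] = [set x | exists s, branch_prefix (least ^~ x) k = s /\
      (exists a, t = rcons s a /\ least s x = a)]).
    apply: measurable_exists => s; apply: measurableI; first exact: IH.
    apply: measurable_exists => a; apply: measurable_andp => _.
    exact: (measurable_preimage (mleast s) (_ : measurable [set a])).
  apply/seteqP; split=> x /= => [<-|[s [<- [a [-> <-]]]]//].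
  exists (branch_prefix (least^~ x) k); split=> //.
  by exists (least (branch_prefix (least^~ x) k) x).
exists f.
  apply: measurable_to_baire => k; apply: measurable_fun_nat => a.
  rewrite (_ : [set _ | _] = [set x | exists s, branch_prefix (least ^~ x) k = s /\
     least s x = a]).
    apply: measurable_exists => s; apply: measurableI; first exact: mpre.
    exact: (measurable_preimage (mleast s) (_ : measurable [set a])).
  rewrite /f /branch; apply/seteqP; split=> x /= => [Yx|[s [<-]]//].
  by exists (branch_prefix (least^~ x) k).
move: aeN; apply: filterS => x Hx xA k; rewrite /f mkseq_branch.
have HB : H (branch_prefix (least^~ x) k) x; last by case: HB.
elim: k => [|k IH]; last by apply: leastP; exact: Hx.
by apply: AH; case: xA => z Hz; exists z.
Qed.

(* Borel-Cantelli *)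
Lemma ae_dominated (f : X -> baire) : measurable_fun setT f ->
  exists n : nat -> nat, \forall x \ae P, exists c, forall k, (f x k <= n k + c)%N.
Proof.
move=> mf.
have mfk k n : measurable [set x | (n < f x k)%N].
  exact: (measurable_preimage (measurableT_comp (measurable_coord k) mf)
    (_ : measurable [set m : nat | (n < m)%N])).
(* The sets where [f x k] exceeds n decrease to the empty set as n grows, so a bound summable in k
   can be met. *)
have /choice[n Hn] k : exists n, P [set x | (n < f x k)%N] <= (1 / (2 ^ k.+1)%:R)%:E.
  pose F n := [set x | (n < f x k)%N].
  have : P \o F @ \oo --> P (\bigcap_n F n).
    apply: nonincreasing_cvg_mu => //.
    - rewrite -ge0_fin_numE//; apply: fin_num_measure; exact: mfk.
    - by move=> n; exact: mfk.
    - by apply: bigcapT_measurable => n; exact: mfk.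
    - move=> m n mn; apply/subsetPset => x; exact: leq_ltn_trans.
  rewrite (_ : \bigcap_n F n = set0); last first.
    by rewrite -subset0 => x /(_ (f x k) Logic.I); rewrite /F /= ltnn.
  rewrite measure0 => cv.
  have e0 : 0 < (1 / (2 ^ k.+1)%:R : R)%:E.
    by rewrite lte_fin divr_gt0// ltr0n expn_gt0.
  have [n _ Hn] := cv _ (open_ereal_lt' e0).
  by exists n; apply: ltW; exact: (Hn n (leqnn n)).
exists n.
pose F k := [set x | (n k < f x k)%N].
have : P (lim_sup_set F) = 0.
  apply: lim_sup_set_cvg0 => [k|]; first exact: mfk.
  apply: le_lt_trans (ltry 1%R).
  apply: le_trans (@epsilon_trick0 R 1%R xpredT ler01).
  by apply: lee_nneseries => // k _; exact: Hn.
have mL : measurable (lim_sup_set F).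
  by apply: bigcapT_measurable => m; apply: bigcup_measurable => k _; exact: mfk.
move=> /(ae_notin mL); apply: filterS => x.
rewrite /lim_sup_set => /existsNP[K /not_implyP[_ HK]].
(* Domination by [n] holds from [K] on; the constant is the largest of the earlier values. *)
exists (\max_(i < K) f x i)%N => k.
have [kK|Kk] := ltnP k K.
  by apply: leq_trans (leq_addl _ _); exact: (leq_bigmax (Ordinal kK)).
apply: leq_trans (leq_addr _ _); rewrite leqNgt; apply/negP => nk.
by apply: HK; exists k.
Qed.

Lemma ae_bounded_branch (B : seq nat -> set X) : (forall s, measurable (B s)) ->
  exists n : baire, \forall x \ae P,
    (exists z, forall k, B (mkseq z k) x) -> bounded_branch B (x, n).
Proof.
move=> mB; have [f mf Hf] := ae_selection mB; have [n Hn] := ae_dominated mf.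
exists n; move: Hf Hn; apply: filterS2 => x Hf [c Hc] /Hf Bx.
by exists c, (f x).
Qed.

End almost_everywhere.

(** * Projections along the Baire space *)

Definition baire_analytic d (X : measurableType d) (A : set X) :=
  exists2 E : set (X * baire), measurable E & A = [set x | exists z, E (x, z)].

Definition baire_lsa (R : realType) d (X : measurableType d) (phi : X -> \bar R) :=
  (forall x, 0 <= phi x)%E /\
  forall c : R, baire_analytic [set x | (phi x < c%:E)%E].

Section envelope.
Context (R : realType).
Local Open Scope ereal_scope.

Lemma measurable_fun_lt d (X : measurableType d) (g : X -> \bar R) (c : \bar R) :
  measurable_fun setT g -> measurable [set x | g x < c].
Proof.
move=> mg; rewrite -[X in measurable X]setTI.
exact: emeasurable_fun_infty_o.
Qed.

Lemma baire_lsaT d (X : measurableType d) (phi : X -> \bar R)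
    (G : X * baire -> \bar R) : (forall x, 0 <= phi x) -> measurable_fun setT G ->
  (forall x (c : R), phi x < c%:E <-> exists z, G (x, z) < c%:E) -> baire_lsa phi.
Proof.
move=> phi0 mG phiG; split=> // c; exists [set p | G p < c%:E].
  exact: measurable_fun_lt.
by apply/seteqP; split=> x /= /phiG.
Qed.

Lemma baire_lsa_comp d d' (X : measurableType d) (Y : measurableType d')
    (f : X -> Y) (phi : Y -> \bar R) :
  measurable_fun setT f -> baire_lsa phi -> baire_lsa (phi \o f).
Proof.
move=> mf [phi0 Ephi]; split=> [x|c]; first exact: phi0.
have [E mE EE] := Ephi c; exists [set p | E (f p.1, p.2)].
  apply: (measurable_preimage _ mE); apply: measurable_fun_pair => //.
  exact: measurableT_comp mf measurable_fst.
apply/seteqP; split=> x /=.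
  by move=> lt; have : [set y | phi y < c%:E] (f x) by []; rewrite EE.
by move=> Ex; suff : [set y | phi y < c%:E] (f x) by []; rewrite EE.
Qed.

(** For each rational r take a scheme for {phi < r}; [G (x, n)] is the infimum of the r for which x
    has a branch bounded, up to a constant, by the row of n attached to r. Each such r exceeds
    [phi x], and choosing every row well for the given law yields equality almost everywhere. *)
Lemma lsa_envelope d (X : measurableType d) (phi : X -> \bar R) : baire_lsa phi ->
  exists G : X * baire -> \bar R, [/\ measurable_fun setT G,
    forall x n, phi x <= G (x, n) &
    forall d' (Y : measurableType d') (P : probability Y R) (f : Y -> X),
      measurable_fun setT f -> exists n, \forall y \ae P, phi (f y) = G (f y, n)].
Proof.
move=> [phi0 Ephi].
(* Enumeration of the rationals; indices coding none give 0. *)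
pose r (i : nat) : R := ratr (odflt 0%R (unpickle i)).
have /choice[B HB] i : exists B : seq nat -> set X, (forall s, measurable (B s)) /\
    forall x, phi x < (r i)%:E <-> exists z, forall k, B (mkseq z k) x.
  have [E mE EE] := Ephi (r i); have [B mB HB] := measurable_scheme mE.
  exists B; split=> // x; split=> [lt|[z Bz]].
    have : [set y | phi y < (r i)%:E] x by [].
    by rewrite EE => -[y /HB[z [_ ?]]]; exists z.
  suff : [set y | phi y < (r i)%:E] x by [].
  by rewrite EE; exists (brow 0 z); apply/HB; exists z.
have mB i s : measurable (B i s) by have [] := HB i.
pose D i (p : X * baire) := bounded_branch (B i) (p.1, brow i p.2).
have mD i : measurable [set p | D i p].
  apply: (measurable_preimage _ (measurable_bounded_branch (mB i))).
  apply: measurable_fun_pair; first exact: measurable_fst.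
  exact: measurableT_comp (measurable_brow i) measurable_snd.
have Dphi i p : D i p -> phi p.1 < (r i)%:E.
  by move=> [c [z [_ zB]]]; apply/(HB i).2; exists z.
pose g i (p : X * baire) := if `[< D i p >] then (r i)%:E else +oo.
pose G p := einfs (g ^~ p) 0%N.
have Gle i p : G p <= g i p by apply: ereal_inf_lbound; exists i.
exists G; split.
- apply: measurable_fun_einfs => i; apply: measurable_fun_ifT => //.
  apply: (measurable_fun_bool true); rewrite setTI.
  rewrite (_ : _ @^-1` _ = [set p | D i p]) //.
  by apply/seteqP; split=> p /= /asboolP.
- move=> x n; apply: le_ereal_inf_tmp => _ [i _ <-].
  by rewrite /g; case: asboolP => [/Dphi/ltW//|_]; rewrite leey.
- move=> d' Y P f mf.
  have /choice[n Hn] i : exists n : baire, \forall y \ae P,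
      phi (f y) < (r i)%:E -> bounded_branch (B i) (f y, n).
    have [n Hn] := @ae_bounded_branch _ _ _ P (fun s => f @^-1` (B i s))
      (fun s => measurable_preimage mf (mB i s)).
    by exists n; move: Hn; apply: filterS => y H /(HB i).2.
  exists (bmerge n); move: (ae_countable Hn); apply: filterS => y Hy.
  apply/eqP; rewrite eq_le; apply/andP; split.
    apply: le_ereal_inf_tmp => _ [i _ <-].
    by rewrite /g; case: asboolP => [/Dphi/ltW//|_]; rewrite leey.
  rewrite leNgt; apply/negP => lt.
  (* A rational strictly in between would itself enter the infimum defining [G], since [y] has a
     bounded branch for it. *)
  have [q /andP[q1 q2]] : exists q : rat, phi (f y) < (ratr q)%:E < G (f y, bmerge n).
    have := phi0 (f y); move: lt; case: (phi (f y)) => [a| |] //; last by rewrite ltNge leey.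
    case: (G _) => [b| |]//=.
      rewrite lte_fin => /rat_in_itvoo[q]; rewrite inE/= => /itvP h _.
      by exists q; rewrite !lte_fin !h.
    move=> _ _; have /rat_in_itvoo[q] : (a < a + 1)%R by rewrite ltrDl.
    by rewrite inE/= => /itvP h; exists q; rewrite lte_fin h ltry.
  have ri : r (pickle q) = ratr q by rewrite /r pickleK.
  have := Gle (pickle q) (f y, bmerge n); rewrite leNgt => /negP; apply.
  rewrite /g asboolT ?ri//.
  by rewrite /D brow_bmerge; apply: Hy; rewrite ri.
Qed.

End envelope.

(** * Integration with respect to completed measures and kernels *)

Section completed_integral.
Context (R : realType) d (X : measurableType d) (P : {measure set X -> \bar R}).
Local Open Scope ereal_scope.
Local Notation I := (caratheodory_type (P^*)%mu).
Local Notation cP := (@completed_measure_extension _ _ _ P).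

Lemma measurable_completed (A : set X) : measurable A -> measurable (A : set I).
Proof. by move=> mA; apply: sub_caratheodory; exact: sub_sigma_algebra. Qed.

Lemma measurable_fun_completed d' (Y : measurableType d') (f : X -> Y) :
  measurable_fun setT f -> measurable_fun [set: I] (f : I -> Y).
Proof.
move=> mf _ B mB; rewrite setTI; apply: measurable_completed.
exact: measurable_preimage.
Qed.

Lemma completed_ae (Q : X -> Prop) : (\forall x \ae P, Q x) ->
  \forall x \ae cP, Q (x : X).
Proof.
move=> [N [mN N0 NQ]]; exists N; split => //; first exact: measurable_completed.
by rewrite -N0; exact: measurable_mu_extE.
Qed.

(** The identity from the completed space to [X] pushes the completion forward to a measure that
    agrees with [P] on measurable sets. *)
Lemma integral_completed_measurable (g : X -> \bar R) :
  measurable_fun setT g -> (forall x, 0 <= g x) ->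
  integral_completed P g = \int[P]_x g x.
Proof.
move=> mg g0.
have mid : measurable_fun [set: I] (id : I -> X) by exact: measurable_fun_completed.
rewrite /integral_completed.
transitivity (\int[pushforward cP (id : I -> X)]_x g x).
  by rewrite ge0_integral_pushforward.
apply: eq_measure_integral => A mA _; exact: measurable_mu_extE.
Qed.

Lemma ae_measurable_completed (phi g : X -> \bar R) :
  measurable_fun setT g -> (\forall x \ae P, phi x = g x) ->
  measurable_fun [set: I] (phi : I -> \bar R).
Proof.
move=> mg e; apply: (@ae_measurable_fun _ I R cP _ _ (g : I -> \bar R)).
- exact: measure_is_complete_caratheodory.
- by apply: (completed_ae (Q := fun x => setT x -> g x = phi x)); move: e; apply: filterS => x ->.
- exact: measurable_fun_completed.
Qed.

Lemma integral_completedE (phi g : X -> \bar R) : measurable_fun setT g ->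
  (forall x, 0 <= g x) -> (\forall x \ae P, phi x = g x) ->
  integral_completed P phi = \int[P]_x g x.
Proof.
move=> mg g0 e; rewrite -integral_completed_measurable//.
apply: ae_eq_integral; first exact: measurableT.
- exact: ae_measurable_completed e.
- exact: measurable_fun_completed.
- by apply: (completed_ae (Q := fun x => setT x -> phi x = g x)); move: e; apply: filterS.
Qed.

End completed_integral.

Section kernel_precomp.
Context (R : realType) d d' d'' (Z : measurableType d) (X : measurableType d')
  (W : measurableType d'') (q : R.-pker X ~> W) (a : Z -> X)
  (ma : measurable_fun setT a).
Local Open Scope ereal_scope.

(** Reindexing by [Z] lets an integrand depend on all of [z] while the measure depends on [a z]
    only. *)
Definition kernel_precomp (z : Z) : {measure set W -> \bar R} := q (a z).

Let measurable_kernel_precomp B : measurable B ->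
  measurable_fun setT (kernel_precomp ^~ B).
Proof.
by move=> mB; apply: (measurableT_comp (measurable_kernel q B mB)).
Qed.

HB.instance Definition _ := isKernel.Build _ _ Z W R kernel_precomp
  measurable_kernel_precomp.

Let kernel_precomp1 z : kernel_precomp z setT = 1.
Proof. exact: prob_kernel. Qed.

HB.instance Definition _ := Kernel_isProbability.Build _ _ Z W R kernel_precomp
  kernel_precomp1.

Lemma measurable_integral_precomp (k : Z * W -> \bar R) :
  (forall p, 0 <= k p) -> measurable_fun setT k ->
  measurable_fun setT (fun z => \int[q (a z)]_w k (z, w)).
Proof.
by move=> k0 mk; exact: (@measurable_fun_integral_finite_kernel _ _ Z W R k kernel_precomp).
Qed.

End kernel_precomp.

Section kernel_probability.
Context (R : realType) d d' (X : measurableType d) (W : measurableType d')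
  (q : R.-pker X ~> W) (x : X).

Definition kernel_measure : set W -> \bar R := q x.
HB.instance Definition _ := Measure.on kernel_measure.

Let kernel_measure1 : kernel_measure setT = 1%E.
Proof. exact: prob_kernel. Qed.

HB.instance Definition _ :=
  Measure_isProbability.Build _ _ _ kernel_measure kernel_measure1.

Definition kernel_probability : probability W R := kernel_measure.

End kernel_probability.

(** * Stability under integration and infimum; approximate selection *)

Section lsa_closure.
Context (R : realType).
Local Open Scope ereal_scope.

(** Every [G (., n)] majorizes [phi], and for each x some n gives equality almost everywhere on the
    section. The integral of [phi] is therefore the minimum over n of integrals that are jointly
    measurable in (x, n). *)
Lemma baire_lsa_integral d d' d'' (X : measurableType d) (X' : measurableType d')
    (W : measurableType d'') (q : R.-pker X' ~> W) (a : X -> X')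
    (phi : X * W -> \bar R) : measurable_fun setT a -> baire_lsa phi ->
  baire_lsa (fun x => integral_completed (q (a x)) (fun w => phi (x, w))).
Proof.
move=> ma lphi; have [phi0 _] := lphi.
have [G [mG phiG eG]] := lsa_envelope lphi.
have G0 p : 0 <= G p by case: p => x n; exact: le_trans (phiG _ _).
have mpairW (x : X) : measurable_fun setT (fun w : W => (x, w)).
  by apply: (@measurable_fun_pair _ _ _ W X W (fun=> x) id).
have mGn (x : X) (n : baire) : measurable_fun setT (fun w => G ((x, w), n)).
  apply: (measurableT_comp mG); apply: measurable_fun_pair => //.
have eqn (x : X) : exists n : baire,
    (forall n', \int[q (a x)]_w G ((x, w), n) <= \int[q (a x)]_w G ((x, w), n')) /\
    integral_completed (q (a x)) (fun w => phi (x, w)) = \int[q (a x)]_w G ((x, w), n).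
  have [n Hn] := eG _ _ (kernel_probability q (a x)) _ (mpairW x); exists n; split; last first.
    exact: integral_completedE.
  move=> n'; apply: ae_ge0_le_integral => //.
  by move: Hn; apply: filterS => w <- _; exact: phiG.
apply: (@baire_lsaT _ _ _ _ (fun p => \int[q (a p.1)]_w G ((p.1, w), p.2))).
- by move=> x; have [n [_ ->]] := eqn x; apply: integral_ge0.
- apply: (@measurable_integral_precomp _ _ _ _ _ _ _ q (a \o fst)
    (measurableT_comp ma measurable_fst) (fun p => G ((p.1.1, p.2), p.1.2))) => //.
  apply: (measurableT_comp mG); apply: measurable_fun_pair.
    apply: measurable_fun_pair; last exact: measurable_snd.
    exact: measurableT_comp measurable_fst measurable_fst.
  exact: measurableT_comp measurable_snd measurable_fst.
move=> x c; have [n [le ->]] := eqn x; split; first by exists n.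
by move=> [n' /=]; exact: le_lt_trans.
Qed.

End lsa_closure.

Definition baire_image d (U : measurableType d) :=
  exists2 pi : baire -> U, measurable_fun setT pi & forall u, exists z, pi z = u.

Section infimum.
Context (R : realType) d d' (X : measurableType d) (U : measurableType d').
Hypothesis imU : baire_image U.
Variables (phi : X * U -> \bar R) (lphi : baire_lsa phi).
Local Open Scope ereal_scope.

Let Psi (x : X) := ereal_inf [set phi (x, u) | u in [set: U]].

(** A branch selected in the scheme of [E] carries a point of the section in its row 0. *)
Lemma measurable_selection (P : probability X R) (E : set (X * baire)) :
  measurable E -> exists2 f : X -> baire, measurable_fun setT f &
    \forall x \ae P, (exists z, E (x, z)) -> E (x, f x).
Proof.
move=> mE; have [B mB HB] := measurable_scheme mE.
have [f mf Hf] := ae_selection P mB.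
exists (brow 0 \o f); first exact: measurableT_comp (measurable_brow 0) mf.
move: Hf; apply: filterS => x Hx [z /HB[y [_ yB]]]; apply/HB.
by exists (f x); split=> //; apply: Hx; exists y.
Qed.

(** Row 0 of z codes the control and row 1 is the parameter of the envelope of [phi], so an infimum
    over [U] becomes one over the Baire space. *)
Lemma inf_parametrized : exists (pi : baire -> U) (G : X * baire -> \bar R),
  [/\ measurable_fun setT pi, measurable_fun setT G,
    forall x z, phi (x, pi (brow 0 z)) <= G (x, z) &
    forall x u, exists z, G (x, z) = phi (x, u)].
Proof.
have [pi mpi pisurj] := imU.
have [G0 [mG0 phiG0 eG0]] := lsa_envelope lphi.
exists pi, (fun p => G0 ((p.1, pi (brow 0 p.2)), brow 1 p.2)); split=> //.
- apply: (measurableT_comp mG0); apply: measurable_fun_pair.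
    apply: measurable_fun_pair; first exact: measurable_fst.
    exact: measurableT_comp mpi (measurableT_comp (measurable_brow 0) measurable_snd).
  exact: measurableT_comp (measurable_brow 1) measurable_snd.
move=> x u; have [z piz] := pisurj u.
(* Under the Dirac measure at (x, u), almost everywhere equality is equality at that point. *)
have [n [N [mN N0 HN]]] := eG0 _ _ (\d_ (x, u)) id (@measurable_id _ _ _).
exists (bmerge (fun i => if i is 0%N then z else n)) => /=.
rewrite !brow_bmerge piz; apply: esym; apply: contrapT => neq.
have /= Nxu := HN (x, u) neq.
have N1 : \d_ (x, u) N = 1 :> \bar R by rewrite diracE mem_set.
by move: (etrans (esym N1) N0) => /eqP; rewrite onee_eq0.
Qed.

Lemma baire_lsa_inf : baire_lsa Psi.
Proof.
have [pi [G [mpi mG phiG Gphi]]] := inf_parametrized.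
apply: (@baire_lsaT _ _ _ _ G) => // [x|x c].
  by apply: le_ereal_inf_tmp => _ [u _ <-]; have [+ _] := lphi; exact.
split=> [lt|[z lt]].
  have [_ [u _ <-] ltu] := ereal_inf_lt lt.
  by have [z Gz] := Gphi x u; exists z; rewrite Gz.
apply: le_lt_trans lt; apply: le_trans (phiG x z).
by apply: ereal_inf_lbound; exists (pi (brow 0 z)).
Qed.

(** A measurable function equal to [Psi] almost everywhere replaces it, which makes the set [E] of
    e-optimal codes measurable and open to selection. *)
Lemma inf_selection (P : probability X R) (e : R) : (0 < e)%R ->
  exists2 u : X -> U, measurable_fun setT u &
    \forall x \ae P, phi (x, u x) <= Psi x + e%:E.
Proof.
move=> e0.
have [pi [G [mpi mG phiG Gphi]]] := inf_parametrized.
have [G' [mG' PsiG' eG']] := lsa_envelope baire_lsa_inf.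
have [n Hn] := eG' _ _ P id (@measurable_id _ _ _).
have mg : measurable_fun setT (fun x => G' (x, n)).
  by apply: (measurableT_comp mG'); exact: measurable_fun_pair.
pose E := [set p : X * baire | G p <= G' (p.1, n) + e%:E].
have mE : measurable E.
  rewrite -[X in measurable X]setTI; apply: measurable_lee => //.
  apply: emeasurable_funD => //.
  exact: (measurableT_comp mg measurable_fst).
have [f mf Hf] := measurable_selection P mE.
exists (pi \o brow 0 \o f).
  exact: measurableT_comp mpi (measurableT_comp (measurable_brow 0) mf).
move: Hn Hf; apply: filterS2 => x Hn Hf.
apply: le_trans (phiG x (f x)) _; rewrite Hn; apply: Hf; rewrite /E /= -Hn.
have Psi0 : 0 <= Psi x by have [+ _] := baire_lsa_inf; exact.
have [fin|] := boolP (Psi x \is a fin_num).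
  have [_ [u _ <-] ltu] := lb_ereal_inf_adherent e0 fin.
  by have [z Gz] := Gphi x u; exists z; rewrite Gz ltW.
(* Where [Psi] is infinite, any code is optimal. *)
rewrite ge0_fin_numE// -leNgt leye_eq => /eqP ->.
by exists point; rewrite addye// leey.
Qed.

End infimum.

(** * Borel spaces *)

(** Countable separation makes the graph of a measurable map measurable. *)
Definition measurably_separated d (T : measurableType d) :=
  exists O : nat -> set T, (forall i, measurable (O i)) /\
    forall x y, (forall i, O i x <-> O i y) -> x = y.

Lemma measurably_separatedX d d' (T : measurableType d) (T' : measurableType d') :
  measurably_separated T -> measurably_separated T' ->
  measurably_separated (T * T')%type.
Proof.
move=> [S [mS sepS]] [S' [mS' sepS']].
exists (fun i => if odd i then fst @^-1` (S i./2) else snd @^-1` (S' i./2)).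
split=> [i|[x x'] [y y'] xy].
  by case: ifP => _; apply: measurable_preimage.
congr pair.
  by apply: sepS => i; have := xy i.*2.+1; rewrite /= odd_double /= uphalf_double.
by apply: sepS' => i; have := xy i.*2; rewrite odd_double doubleK.
Qed.

Lemma natSinv_lt (R : realType) (e : R) : 0 < e -> exists n, (n.+1%:R^-1 < e)%R.
Proof.
move=> e0; near \oo => n; exists n; near: n.
exact: near_infty_natSinv_lt (PosNum e0).
Unshelve. all: by end_near. Qed.

Section polish.
Context (R : realType) (P : completePseudoMetricType R).
Hypothesis polishP : polish_space P.

Let rad k : R := k.+1%:R^-1.
Let rad0 k : 0 < rad k. Proof. by rewrite invr_gt0. Qed.
Let rad20 k : 0 < rad k / 2. Proof. by rewrite divr_gt0. Qed.

Lemma dense_sequence : exists u : nat -> P, forall p e, 0 < e -> exists n, ball (u n) e p.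
Proof.
have [_ [D /countable_injP[f finj] denseD]] := polishP.
(* Indices outside the image of [f] give the default [point], which is harmless since density only
   needs the points of [D] to be reached. *)
exists (fun n => xget point [set p | D p /\ f p = n]) => p e e0.
have [q [/interior_subset pq Dq]] : (ball p e)° `&` D !=set0.
  have [? ?] := open_nbhs_ball p (PosNum e0).
  by apply: denseD => //; exists p.
exists (f q); rewrite (_ : xget _ _ = q); first exact: ball_sym.
case: xgetP => [r _ [Dr fr]|/(_ q)]; last by case.
by apply: finj; rewrite ?inE.
Qed.

(** The points are within 2 / (k + 1) of each other for all k, so disjoint balls separating them
    would meet. *)
Lemma ball_center_eq (u : nat -> P) p q :
  (forall k, exists n, ball (u n) (rad k) p /\ ball (u n) (rad k) q) -> p = q.
Proof.
move=> pq; have [+ _] := polishP; rewrite ball_hausdorff => sep.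
apply/eqP; apply: contrapT => /negP /sep[[r s] /= /eqP /seteqP[H _]].
have m0 : 0 < r%:num / 2 by rewrite divr_gt0.
have [l Hl] := natSinv_lt m0; have [n [np nq]] := pq l.
apply: (H q); split; last exact: ballxx.
apply: (@le_ball _ _ _ (rad l + rad l)); first by rewrite [leRHS]splitr lerD// ltW.
by apply: ball_triangle nq; exact: ball_sym.
Qed.

(** An open set is the union of the closed half-radius balls, centred on the dense sequence, whose
    full-radius ball it contains. *)
Lemma open_souslin_closed (O : set P) : open O -> souslin closed O.
Proof.
move=> oO; have [u Hu] := dense_sequence.
pose F m := if `[< ball (u (nunpair m).1) (rad (nunpair m).2) `<=` O >]
  then closed_ball (u (nunpair m).1) (rad (nunpair m).2 / 2) else set0.
rewrite (_ : O = \bigcup_m F m).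
  apply: souslin_bigcup; first exact: closedT.
  move=> m; apply: souslin_self; rewrite /F; case: ifP => _.
    exact: closed_ball_closed.
  exact: closed0.
apply/seteqP; split=> p; last first.
  move=> [m _]; rewrite /F; case: asboolP => // sub.
  by move/(subset_closure_half (rad0 _)); exact: sub.
move=> Op; have /nbhs_ballP[e /= e0 eO] : nbhs p O by exact: open_nbhs_nbhs.
have [k ke] := natSinv_lt (divr_gt0 e0 (ltr0n R 2)).
have [n Hn] := Hu p (rad k / 2) (rad20 k).
exists (npair n k) => //; rewrite /F npairK /= asboolT.
  exact: subset_closed_ball.
move=> q /= nq; apply: eO.
have half : rad k / 2 <= e / 2.
  rewrite ler_pM2r// (le_trans (ltW ke))// ler_pdivrMr// ler_peMr//; first exact: ltW.
  by rewrite ler1n.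
apply: (@ball_splitr _ _ (u n)).
  by apply: le_ball Hn.
by apply: (le_ball (ltW ke)).
Qed.

Lemma borel_souslin_closed (A : set P) :
  <<s [set O : set P | open O] >> A -> souslin closed A.
Proof.
apply: souslin_sigma; [exact: closedT|exact: closed0|move=> O /= oO; split].
  exact: open_souslin_closed.
by apply: souslin_self; exact: open_closedC.
Qed.

Section image.
Context d (U : measurableType d) (e : U -> P).
Hypotheses (inje : injective e)
  (range_borel : <<s [set O : set P | open O] >> (range e))
  (measurableE : (measurable : set (set U)) =
     [set e @^-1` B | B in <<s [set O : set P | open O] >>]).

(** A code determines at most one point because its balls shrink. By completeness it is valid once
    its finite parts are consistent, which is a countable condition; invalid codes are sent to
    [point]. *)
Lemma baire_image_embedding : baire_image U.
Proof.
have [u Hu] := dense_sequence.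
have [B cB rangeE] := borel_souslin_closed range_borel.
pose cb k n := closed_ball (u n) (rad k / 2).
have cb_ball k n p : cb k n p -> ball (u n) (rad k) p.
  exact: subset_closure_half.
(* [z] codes the point [p]: the first row is a branch of the scheme of the range
   of [e], the second one a sequence of small balls containing [p] *)
pose Q (z : baire) p := (forall k, B (mkseq (brow 0 z) k) p) /\
                        (forall k, cb k (brow 1 z k) p).
have Quniq z p q : Q z p -> Q z q -> p = q.
  by move=> [_ Qp] [_ Qq]; apply: (@ball_center_eq u) => k; exists (brow 1 z k);
    split; apply: cb_ball.
pose K (s t : seq nat) : set P := [set p | forall i, (i < size s)%N ->
  B (take i s) p /\ cb i (nth 0%N t i) p].
have Qex z : (exists p, Q z p) <->
    forall k, K (mkseq (brow 0 z) k) (mkseq (brow 1 z) k) !=set0.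
  split=> [[p [Qp1 Qp2]] k|/choice[p Hp]].
    exists p => i; rewrite size_mkseq => ik; rewrite take_mkseq 1?ltnW// nth_mkseq//.
  have Kp i j : (i < j)%N -> B (mkseq (brow 0 z) i) (p j) /\ cb i (brow 1 z i) (p j).
    move=> ij; have := Hp j i; rewrite size_mkseq => /(_ ij).
    by rewrite take_mkseq 1?ltnW// nth_mkseq.
  (* The witnesses of the finite parts are eventually in every ball of the code, so they converge,
     and the limit stays in the closed sets of the scheme. *)
  have /cauchy_cvg cp : cauchy (p @ \oo).
    apply: cauchy_exP => eps eps0; have [k ke] := natSinv_lt eps0.
    exists (u (brow 1 z k)); exists k.+1 => // j /= kj.
    by apply: (le_ball (ltW ke)); apply: cb_ball; have [] := Kp _ _ kj.
  exists (lim (p @ \oo)); split=> k.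
    apply: (closed_cvg _ (cB (mkseq (brow 0 z) k))) cp.
    by exists k.+1 => // j /= kj; have [] := Kp _ _ kj.
  apply: (closed_cvg _ (@closed_ball_closed _ _ (u (brow 1 z k)) (rad k / 2))) cp.
  by exists k.+1 => // j /= kj; have [] := Kp _ _ kj.
have mQ : measurable [set z | exists p, Q z p].
  rewrite (_ : [set _ | _] = [set z | forall k, exists s t, K s t !=set0 /\
     (mkseq (brow 0 z) k = s /\ mkseq (brow 1 z) k = t)]).
    apply: measurable_forall => k; apply: measurable_exists => s.
    apply: measurable_exists => t; apply: measurable_andp => _.
    by apply: measurableI; apply: measurable_mkseq_eq => i _;
      exact: measurableT_comp (measurable_coord i) (measurable_brow _).
  apply/seteqP; split=> z /=.
    move=> /Qex H k; exists (mkseq (brow 0 z) k), (mkseq (brow 1 z) k).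
    by split; first exact: H.
  by move=> H; apply/Qex => k; have [s [t [Kst [-> ->]]]] := H k.
(* Induction over the generated sigma-algebra; the complement case uses the uniqueness of the coded
   point. *)
have mQB A : <<s [set O : set P | open O] >> A ->
    measurable [set z | exists p, Q z p /\ A p].
  pose S := [set A | measurable [set z | exists p, Q z p /\ A p]].
  move=> sA; suff : S A by [].
  apply: sA; split; last first.
    move=> O /= oO; rewrite /S /=.
    (* An open set contains the coded point exactly when it contains one of the closed balls of the
       code. *)
    rewrite (_ : [set _ | _] = [set z | exists p, Q z p] `&`
      [set z | exists k, exists n, cb k n `<=` O /\ brow 1 z k = n]).
      apply: measurableI => //; apply: measurable_exists => k.
      apply: measurable_exists => n; apply: measurable_andp => _.
      apply: (measurable_preimage (measurableT_comp (measurable_coord k)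
        (measurable_brow 1)) (_ : measurable [set n])) => //.
    apply/seteqP; split=> z /=.
      move=> [p [Qp Op]]; split; first by exists p.
      have /nbhs_ballP[eps /= eps0 epsO] : nbhs p O by exact: open_nbhs_nbhs.
      have [k ke] := natSinv_lt (divr_gt0 eps0 (ltr0n R 2)).
      exists k, (brow 1 z k); split=> // q /cb_ball qk; apply: epsO.
      apply: (@ball_splitr _ _ (u (brow 1 z k))); apply: (le_ball (ltW ke)) => //.
      by apply: cb_ball; case: Qp.
    move=> [[p Qp] [k [n [sub zn]]]]; subst n; exists p; split=> //.
    by apply: sub; case: Qp.
  split.
  - rewrite /S /= (_ : [set _ | _] = set0)//.
    by rewrite -subset0 => z [p []].
  - move=> C mC; rewrite /S /= (_ : [set _ | _] = [set z | exists p, Q z p] `\`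
      [set z | exists p, Q z p /\ C p]); first exact: measurableD.
    apply/seteqP; split=> z /=.
      move=> [p [Qp [_ nCp]]]; split; first by exists p.
      by move=> [q [Qq Cq]]; apply: nCp; rewrite (Quniq _ _ _ Qp Qq).
    by move=> [[p Qp] nC]; exists p; split=> //; split=> // Cp; apply: nC; exists p.
  - move=> F mF; rewrite /S /= (_ : [set _ | _] = \bigcup_n
      [set z | exists p, Q z p /\ F n p]).
      by apply: bigcup_measurable => n _; exact: mF.
    apply/seteqP; split=> z /=.
      by move=> [p [Qp [n _ Fp]]]; exists n => //; exists p.
    by move=> [n _ [p [Qp Fp]]]; exists p; split=> //; exists n.
have Qrange z p : Q z p -> exists v, e v = p.
  move=> [Qp _]; have [v _ <-] : range e p by rewrite rangeE; exists (brow 0 z).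
  by exists v.
pose pi (z : baire) : U := xget point [set v | Q z (e v)].
have piE z v : Q z (e v) -> pi z = v.
  move=> Qv; rewrite /pi; case: xgetP => [w _ Qw|/(_ v)]; last by [].
  by apply: inje; exact: Quniq Qw Qv.
exists pi; last first.
  move=> v; have : range e (e v) by exists v.
  rewrite rangeE => -[z0 Hz0].
  have /choice[n Hn] k : exists n, cb k n (e v).
    have [n Hn] := Hu (e v) (rad k / 2) (rad20 k); exists n.
    exact: subset_closed_ball.
  exists (bmerge (fun i => if i is 0%N then z0 else n)).
  by apply: piE; split=> k; rewrite brow_bmerge.
move=> _ A; rewrite measurableE setTI => -[C sC <-].
(* The second set accounts for the invalid codes. *)
rewrite (_ : _ @^-1` _ = [set z | exists p, Q z p /\ C p] `|`
   [set z | C (e point) /\ ~ exists p, Q z p]).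
  apply: measurableU; first exact: mQB.
  by apply: measurable_andp => _; exact: measurableC.
apply/seteqP; split=> z /=.
  have [[p Qp] Cz|nQ Cz] := pselect (exists p, Q z p).
    left; have [v ev] := Qrange _ _ Qp; exists p; split => //.
    by move: Cz; rewrite (piE z v) ev.
  right; split=> //; move: Cz; rewrite /pi; case: xgetP => // v _ Qv.
  by case: nQ; exists (e v).
move=> [[p [Qp Cp]]|[Ce nQ]].
  by have [v ev] := Qrange _ _ Qp; rewrite (piE z v) ev.
rewrite /pi; case: xgetP => // v _ Qv.
by case: nQ; exists (e v).
Qed.

Lemma separating_embedding : measurably_separated U.
Proof.
have [u Hu] := dense_sequence.
exists (fun m => e @^-1` closed_ball (u (nunpair m).1) (rad (nunpair m).2 / 2)).
split=> [m|x y xy].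
  rewrite measurableE; exists (closed_ball (u (nunpair m).1) (rad (nunpair m).2 / 2)) => //.
  rewrite -[X in <<s _ >> X]setCK; apply: sigma_algebraC; apply: sub_sigma_algebra.
  exact: closed_openC (@closed_ball_closed _ _ _ _).
apply: inje; apply: (@ball_center_eq u) => k.
have [n Hn] := Hu (e x) (rad k / 2) (rad20 k); exists n.
have Hx := subset_closed_ball Hn.
split; apply: subset_closure_half => //.
by have := xy (npair n k); rewrite npairK /= => -[+ _]; exact.
Qed.

End image.

End polish.

Lemma borel_space_baire_image (R : realType) d (U : measurableType d) :
  borel_space R U -> baire_image U.
Proof. by move=> [P [e [polishP ? ? ?]]]; exact: (baire_image_embedding polishP (e := e)). Qed.

Lemma borel_space_separated (R : realType) d (U : measurableType d) :
  borel_space R U -> measurably_separated U.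
Proof. by move=> [P [e [polishP ? ? ?]]]; exact: (separating_embedding polishP (e := e)). Qed.

(** With [B] parametrized by the Baire space, x lies in the image when some z has [pi z] in [B] and
    [f (pi z) = x]; the separating family turns this equation into a measurable condition on (x,
    z). *)
Lemma analytic_set_baire (R : realType) d (T : measurableType d) (A : set T) :
  measurably_separated T -> analytic_set R A -> baire_analytic A.
Proof.
move=> [S [mS sepS]] [d' [Y [f [B [bY mf mB ->]]]]].
have [pi mpi pisurj] := borel_space_baire_image bY.
exists ([set p : T * baire | B (pi p.2)] `&`
        [set p | forall i, (S i (f (pi p.2)) <-> S i p.1)]).
  have mg : measurable_fun setT (fun p : T * baire => pi p.2).
    exact: measurableT_comp mpi measurable_snd.
  apply: measurableI; first exact: (measurable_preimage mg mB).
  apply: measurable_forall => i.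
  have m1 : measurable [set p : T * baire | S i (f (pi p.2))].
    exact: (measurable_preimage (measurableT_comp mf mg) (mS i)).
  have m2 : measurable [set p : T * baire | S i p.1].
    exact: (measurable_preimage measurable_fst (mS i)).
  rewrite (_ : (fun _ => _) = ([set p : T * baire | S i (f (pi p.2))] `&` [set p | S i p.1]) `|`
     (~` [set p : T * baire | S i (f (pi p.2))] `&` ~` [set p | S i p.1])).
    by apply: measurableU; apply: measurableI => //; exact: measurableC.
  apply/seteqP; split=> p /=; last by move=> [[? ?]|[? ?]]; split.
  move=> [H1 H2]; have [op|nop] := pselect (S i p.1); first by left; split=> //; exact: H2.
  by right; split=> // /H1.
apply/seteqP; split=> t /=.
  by move=> [y By <-]; have [z zy] := pisurj y; exists z; rewrite zy; split.
by move=> [z [Bz Sz]]; exists (pi z) => //; exact: sepS.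
Qed.

Lemma lower_semianalytic_baire (R : realType) d (T : measurableType d)
    (phi : T -> \bar R) :
  measurably_separated T -> lower_semianalytic phi -> baire_lsa phi.
Proof. by move=> sT [phi0 aphi]; split=> // c; exact: analytic_set_baire. Qed.

(** * Dynamic programming *)

Section step_integral.
Context (R : realType) (dH dU dW : measure_display) (H : measurableType dH)
  (U : measurableType dU) (W : measurableType dW) (rho : R.-pker H ~> W)
  (g : univ_mfun R H U) (P : probability H R).
Local Open Scope ereal_scope.
Local Notation I := (caratheodory_type (P^*)%mu).
Local Notation cP := (@completed_measure_extension _ _ _ P).

Lemma measurable_univ_mfun : measurable_fun [set: I] (g : I -> U).
Proof.
move=> _ B mB; rewrite setTI.
have [A mA [N [C [mC PC0 NC]]] <-] := univ_mfunP g mB P.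
apply: measurableU; first exact: measurable_completed.
apply: measure_is_complete_caratheodory; exists (C : set I); split => //.
  exact: measurable_completed.
by rewrite -PC0; exact: measurable_mu_extE.
Qed.

Let measurable_point : measurable_fun [set: I] (fun h : I => h : H).
Proof. by move=> _ B mB; rewrite setTI; exact: measurable_completed. Qed.

Let append (p : I * W) : H * (U * W) := (p.1 : H, (g p.1, p.2)).

Let measurable_append : measurable_fun [set: I * W] append.
Proof.
apply: (@measurable_fun_pair _ _ _ (I * W)%type H (U * W)%type
  (fun p => p.1 : H) (fun p => (g p.1, p.2))).
  exact: (measurableT_comp measurable_point measurable_fst).
apply: measurable_fun_pair; last exact: measurable_snd.
exact: (measurableT_comp measurable_univ_mfun measurable_fst).
Qed.

Let measurable_append1 h : measurable_fun [set: W] (fun w => append (h, w)).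
Proof.
apply: (measurableT_comp measurable_append).
by apply: (@measurable_fun_pair _ _ _ W I W (fun=> h) id).
Qed.

Lemma measurable_step_integral (F : H * (U * W) -> \bar R) :
  (forall p, 0 <= F p) -> measurable_fun setT F ->
  measurable_fun [set: I] (fun h : I => \int[rho h]_w F (h : H, (g h, w))).
Proof.
move=> F0 mF.
apply: (@measurable_integral_precomp _ _ _ _ I H W rho (fun h : I => h : H) _
  (fun p => F (append p))) => //.
exact: measurableT_comp mF measurable_append.
Qed.

(** [outer] and [inner] present the step law as a composition of kernels: the completion of [P], out
    of a one-point space, then the law of (h, (g h, w)) for w drawn from [rho h]. Its integrals then
    disintegrate as for any such composition. *)
Let outer (_ : unit) : {measure set I -> \bar R} := cP.

Let measurable_outer B : measurable B -> measurable_fun setT (outer ^~ B).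
Proof. by move=> _; exact: measurable_cst. Qed.

HB.instance Definition _ := isKernel.Build _ _ unit I R outer measurable_outer.

Let outer1 x : outer x setT = 1.
Proof. by rewrite -[RHS](@probability_setT _ _ _ P); exact: measurable_mu_extE. Qed.

HB.instance Definition _ := Kernel_isProbability.Build _ _ unit I R outer outer1.

Let inner (p : unit * I) : {measure set (H * (U * W)) -> \bar R}.
Proof.
by refine (pushforward (rho p.2) (fun w => append (p.2, w))); exact: measurable_append1.
Defined.

Let measurable_inner B : measurable B -> measurable_fun setT (inner ^~ B).
Proof.
move=> mB; rewrite /inner /pushforward.
have -> : (fun p : unit * I => rho p.2 ((fun w => append (p.2, w)) @^-1` B)) =
   (fun p => \int[rho p.2]_w (\1_B (append (p.2, w)))%:E).
  apply/funext => p.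
  have mA := measurable_preimage (measurable_append1 p.2) mB.
  by rewrite -[in LHS](setIT (_ @^-1` _)) -(integral_indic _ measurableT mA).
apply: (@measurable_integral_precomp _ _ _ _ (unit * I)%type H W rho (fun p => p.2 : H) _
  (fun p => (\1_B (append (p.1.2, p.2)))%:E)) => //.
- exact: (measurableT_comp measurable_point measurable_snd).
have ma : measurable_fun setT (fun p : unit * I * W => append (p.1.2, p.2)).
  apply: (measurableT_comp measurable_append).
  apply: measurable_fun_pair; last exact: measurable_snd.
  exact: measurableT_comp measurable_snd measurable_fst.
have mi : measurable_fun setT (\1_B : H * (U * W) -> R) by exact: measurable_indic.
by apply/measurable_EFinP; exact: (measurableT_comp mi ma).
Qed.

HB.instance Definition _ := isKernel.Build _ _ (unit * I)%type
  (H * (U * W))%type R inner measurable_inner.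

Let inner1 p : inner p setT = 1.
Proof. exact: (@prob_kernel _ _ _ _ _ rho p.2). Qed.

HB.instance Definition _ := Kernel_isProbability.Build _ _ (unit * I)%type
  (H * (U * W))%type R inner inner1.

Lemma integral_step_prob (F : H * (U * W) -> \bar R) :
  (forall p, 0 <= F p) -> measurable_fun setT F ->
  \int[step_prob rho g P]_p F p =
  integral_completed P (fun h => \int[rho h]_w F (h, (g h, w))).
Proof.
move=> F0 mF.
transitivity (\int[kcomp outer inner tt]_p F p).
  exact: eq_measure_integral.
rewrite (integral_kcomp outer inner)//; apply: eq_integral => h _.
rewrite ge0_integral_pushforward// => ?; exact: measurable_append1.
Qed.

End step_integral.

Section lsa_integral.
Context (R : realType) d (X : measurableType d).
Variables (phi : X -> \bar R) (lphi : baire_lsa phi).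
Local Open Scope ereal_scope.

Lemma baire_lsa_majorant (P : probability X R) : exists k : X -> \bar R,
  [/\ measurable_fun setT k, forall x, phi x <= k x & \forall x \ae P, phi x = k x].
Proof.
have [G [mG phiG eG]] := lsa_envelope lphi.
have [n Hn] := eG _ _ P id (@measurable_id _ _ _).
exists (fun x => G (x, n)); split=> //.
exact: (measurableT_comp mG (@measurable_fun_pair _ _ _ X X baire id (fun=> n) _ _)).
Qed.

Lemma baire_lsa_measurable (P : probability X R) :
  measurable_fun [set: caratheodory_type (P^*)%mu] (phi : caratheodory_type _ -> _).
Proof.
by have [k [mk _ Hk]] := baire_lsa_majorant P; exact: ae_measurable_completed Hk.
Qed.

Lemma integral_completed_le_measurable (P : probability X R) (k : X -> \bar R) :
  measurable_fun setT k -> (forall x, phi x <= k x) ->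
  integral_completed P phi <= \int[P]_x k x.
Proof.
move=> mk phik; have [phi0 _] := lphi.
have k0 x : 0 <= k x by exact: le_trans (phik x).
rewrite -integral_completed_measurable//; apply: ge0_le_integral; first exact: measurableT.
- by move=> x _.
- exact: baire_lsa_measurable.
- exact: measurable_fun_completed.
- by move=> x _.
Qed.

(** A measurable majorant adapted to [P] is adapted to [Q] too, its exceptional set being contained
    in a measurable null set. *)
Lemma integral_completed_eq (P Q : probability X R) :
  (forall A, measurable A -> P A = Q A) ->
  integral_completed P phi = integral_completed Q phi.
Proof.
move=> PQ; have [phi0 _] := lphi.
have [k [mk phik [N [mN N0 HN]]]] := baire_lsa_majorant P.
have k0 x : 0 <= k x by exact: le_trans (phik x).
rewrite (integral_completedE mk k0); last by exists N.
rewrite (integral_completedE mk k0); last first.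
  by exists N; split=> //; exact: etrans (esym (PQ _ mN)) N0.
by apply: eq_measure_integral => A mA _; exact: PQ.
Qed.

Lemma integral_completed_dirac x : integral_completed (\d_ x) phi = phi x.
Proof.
have [phi0 _] := lphi.
have [k [mk phik Hk]] := baire_lsa_majorant (\d_ x).
have k0 y : 0 <= k y by exact: le_trans (phik y).
rewrite (integral_completedE mk k0 Hk) integral_dirac//.
rewrite diracT mul1e; have [N [mN N0 HN]] := Hk.
apply: contrapT => neq; have /= Nx := HN x (fun e => neq (esym e)).
have N1 : \d_ x N = 1 :> \bar R by rewrite diracE mem_set.
by move: (etrans (esym N1) N0) => /eqP; rewrite onee_eq0.
Qed.

End lsa_integral.

Section step_bounds.
Context (R : realType) (dH dU dW : measure_display) (H : measurableType dH)
  (U : measurableType dU) (W : measurableType dW) (rho : R.-pker H ~> W)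
  (P : probability H R) (phi : H * (U * W) -> \bar R).
Hypothesis (lphi : baire_lsa phi).
Local Open Scope ereal_scope.
Local Notation I := (caratheodory_type (P^*)%mu).
Local Notation cP := (@completed_measure_extension _ _ _ P).

Definition step_cost (p : H * U) : \bar R :=
  integral_completed (rho p.1) (fun w => phi (p.1, (p.2, w))).

(** The one-step Bellman operator applied to [phi]. *)
Definition step_value (h : H) : \bar R :=
  ereal_inf [set step_cost (h, u) | u in [set: U]].

Lemma baire_lsa_step_cost : baire_lsa step_cost.
Proof.
apply: (@baire_lsa_integral R _ _ _ (H * U)%type H W rho fst
  (fun p => phi (p.1.1, (p.1.2, p.2)))); first exact: measurable_fst.
apply: (@baire_lsa_comp _ _ _ (H * U * W)%type (H * (U * W))%type
  (fun p => (p.1.1, (p.1.2, p.2)))) => //.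
apply: measurable_fun_pair.
  exact: measurableT_comp measurable_fst measurable_fst.
apply: measurable_fun_pair; last exact: measurable_snd.
exact: measurableT_comp measurable_snd measurable_fst.
Qed.

Lemma baire_lsa_step_value : baire_image U -> baire_lsa step_value.
Proof. by move=> imU; apply: baire_lsa_inf => //; exact: baire_lsa_step_cost. Qed.

Lemma step_cost_ge0 p : 0 <= step_cost p.
Proof. by have [+ _] := baire_lsa_step_cost; exact. Qed.

(** With [k] a measurable majorant of [phi], equal to it almost everywhere under the step law, [J h]
    integrates [k] over the section at h. This bypasses the composition of [step_cost] with a merely
    universally measurable [g]. *)
Lemma integral_step_cost (g : univ_mfun R H U) : exists J : H -> \bar R,
  [/\ integral_completed (step_prob rho g P) phi = integral_completed P J,
    measurable_fun [set: I] (J : I -> \bar R),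
    forall h, step_cost (h, g h) <= J h &
    \forall h \ae cP, step_cost (h, g h) = J h].
Proof.
have [phi0 _] := lphi.
have [k [mk phik [N [mN N0 HN]]]] := baire_lsa_majorant lphi (step_prob rho g P).
have k0 p : 0 <= k p by exact: le_trans (phik p).
have msection h : measurable_fun [set: W] (fun w => (h, (g h, w)) : H * (U * W)).
  apply: (@measurable_fun_pair _ _ _ W H (U * W)%type (fun=> h) _) => //.
have mkh h : measurable_fun [set: W] (fun w => k (h, (g h, w))).
  exact: measurableT_comp mk (msection h).
have lphih h : baire_lsa (fun w => phi (h, (g h, w))).
  exact: (baire_lsa_comp (msection h) lphi).
exists (fun h => \int[rho h]_w k (h, (g h, w))); split.
- rewrite (integral_completedE mk k0); last by exists N.
  exact: integral_step_prob.
- exact: measurable_step_integral.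
- move=> h; apply: (integral_completed_le_measurable (lphih h)
    (kernel_probability rho h)).
  + exact: mkh.
  + by move=> w; exact: phik.
have mNs h : measurable [set w | N (h, (g h, w))].
  exact: (measurable_preimage (msection h) mN).
have NsE h : rho h [set w | N (h, (g h, w))] = \int[rho h]_w (\1_N (h, (g h, w)))%:E.
  by rewrite -[in LHS](setIT (mkset _)) -(integral_indic _ measurableT (mNs h)).
have ind0 (p : H * (U * W)) : 0 <= (\1_N p : R)%:E by rewrite lee_fin.
have mind : measurable_fun setT (fun p : H * (U * W) => (\1_N p : R)%:E).
  by apply/measurable_EFinP; exact: measurable_indic.
have mNs' : measurable_fun [set: I] (fun h : I => rho h [set w | N (h, (g h, w))]).
  rewrite (_ : (fun h : I => _) = (fun h : I => \int[rho h]_w (\1_N (h : H, (g h, w)))%:E)).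
    exact: (@measurable_step_integral _ _ _ _ _ _ _ rho g P _ ind0 mind).
  by apply/funext => h; exact: NsE.
(* The step law of the exceptional set integrates the measures of its sections, so almost all
   sections are null. *)
have : \int[cP]_h `|rho h [set w | N ((h : H), (g h, w))]| = 0.
  rewrite -N0 /step_prob/= /step_law /integral_completed.
  by apply: eq_integral => h _; rewrite gee0_abs.
move=> /(ae_eq_integral_abs _ measurableT mNs').
apply: filterS => h /(_ Logic.I) Nh0.
apply: (@integral_completedE _ _ _ (rho h)) => //.
by exists [set w | N (h, (g h, w))]; split => // w /= neq; apply: HN.
Qed.

Lemma step_value_lower_bound (g : univ_mfun R H U) : baire_image U ->
  integral_completed P step_value <= integral_completed (step_prob rho g P) phi.
Proof.
move=> imU; have lv := baire_lsa_step_value imU.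
have [J [-> mJ costJ _]] := integral_step_cost g.
apply: ge0_le_integral; first exact: measurableT.
- by move=> h _; have [+ _] := lv; exact.
- exact: baire_lsa_measurable.
- exact: mJ.
- move=> h _; apply: le_trans (costJ h).
  by apply: ereal_inf_lbound; exists (g h).
Qed.

Lemma measurable_fun_universally (u : H -> U) : measurable_fun setT u ->
  forall B, measurable B -> universally_measurable R (u @^-1` B).
Proof.
move=> mu B mB Q; exists (u @^-1` B); first exact: measurable_preimage.
by exists set0; [exact: negligible_set0|rewrite setU0].
Qed.

(** The control is the Borel selection of [inf_selection]; e-optimality P-almost everywhere suffices
    under the integral. *)
Lemma step_value_upper_bound (e : R) : baire_image U -> (0 < e)%R ->
  exists g : univ_mfun R H U,
  integral_completed (step_prob rho g P) phi <= integral_completed P step_value + e%:E.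
Proof.
move=> imU e0; have lv := baire_lsa_step_value imU.
have [v0 _] := lv.
have [u mu Hu] := inf_selection imU baire_lsa_step_cost P e0.
exists (UnivMFun (measurable_fun_universally mu)).
have [J [-> mJ costJ Jcost]] := integral_step_cost (UnivMFun (measurable_fun_universally mu)).
have mv := baire_lsa_measurable (P := P) lv.
have -> : integral_completed P step_value + e%:E =
    \int[cP]_h (step_value (h : H) + e%:E).
  rewrite ge0_integralD//; last by move=> ? _; rewrite lee_fin ltW.
  rewrite integral_cst// [X in e%:E * X](_ : _ = 1) ?mule1//.
  by rewrite -[RHS](@probability_setT _ _ _ P); exact: measurable_mu_extE.
apply: ae_ge0_le_integral.
- exact: measurableT.
- by move=> h _; apply: le_trans (costJ h); exact: step_cost_ge0.
- exact: mJ.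
- by move=> h _; rewrite adde_ge0// lee_fin ltW.
- by apply: emeasurable_funD; [exact: mv|exact: measurable_cst].
- move: Jcost (completed_ae Hu).
  by apply: (@filterS2 _ _ (ae_filter_ringOfSetsType cP)) => h <- Hh _; exact: Hh.
Qed.

End step_bounds.

(** * Iterating the one-step equation over the horizon *)

Section dynamic_programming.
Context (R : realType) (dU dW : nat -> measure_display)
  (U : forall t, measurableType (dU t)) (W : forall t, measurableType (dW t))
  (rho : forall s, R.-pker (hist U W s) ~> W s.+1).
Local Open Scope ereal_scope.

Definition dp_step s (phi : hist U W s.+1 -> \bar R) : hist U W s -> \bar R :=
  step_value (rho s) phi.

Fixpoint dp_iter t n : (hist U W (n + t) -> \bar R) -> hist U W t -> \bar R :=
  if n is n'.+1 return (hist U W (n + t) -> \bar R) -> hist U W t -> \bar R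
  then fun phi => @dp_iter t n' (dp_step phi)
  else fun phi => phi.

Lemma baire_lsa_dp_step s (phi : hist U W s.+1 -> \bar R) :
  baire_image (U s) -> baire_lsa phi -> baire_lsa (dp_step phi).
Proof. by move=> imU lphi; exact: baire_lsa_step_value. Qed.

Definition update_policy (g : policy R U W) s (gs : univ_mfun R (hist U W s) (U s)) :
    policy R U W :=
  fun k => match @eqP _ s k with
  | ReflectT e => ecast k (univ_mfun R (hist U W k) (U k)) e gs
  | ReflectF _ => g k
  end.

Lemma update_policy_same g s gs : @update_policy g s gs s = gs.
Proof. by rewrite /update_policy; case: eqP => // e; rewrite (eq_axiomK e). Qed.

Lemma update_policy_other g s gs k : k <> s -> @update_policy g s gs k = g k.
Proof. by rewrite /update_policy => ks; case: eqP => // e; case: ks. Qed.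

Lemma eq_law_after (g g' : policy R U W) t (h : hist U W t) n :
  (forall k, (k < n)%N -> g (k + t)%N = g' (k + t)%N) ->
  law_after rho g h n = law_after rho g' h n.
Proof.
elim: n => //= n IH gg'; rewrite gg'// IH// => k kn.
by apply: gg'; exact: leqW.
Qed.

(** Induction peels off the last step, whose control costs at least [dp_step phi] on average; with
    no step left the law is a Dirac measure. *)
Lemma dp_iter_lower_bound (g : policy R U W) t (h : hist U W t) n
    (phi : hist U W (n + t) -> \bar R) :
  (forall k, (k < n)%N -> baire_image (U (k + t)%N)) -> baire_lsa phi ->
  dp_iter phi h <= integral_completed (law_after rho g h n) phi.
Proof.
elim: n phi => [|n IH] phi imU lphi.
  rewrite le_eqVlt; apply/orP; left; apply/eqP.
  exact: esym (integral_completed_dirac lphi h).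
apply: le_trans (step_value_lower_bound _ _ lphi _ _); last exact: imU.
apply: IH; last by apply: baire_lsa_dp_step => //; exact: imU.
by move=> k kn; apply: imU; exact: leqW.
Qed.

(** Half of e is spent on the earlier steps and half on the last one, whose control is chosen once
    the law of the earlier ones is fixed. *)
Lemma dp_iter_upper_bound t (h : hist U W t) n
    (phi : hist U W (n + t) -> \bar R) (e : R) :
  (forall k, (k < n)%N -> baire_image (U (k + t)%N)) -> baire_lsa phi -> (0 < e)%R ->
  exists g, integral_completed (law_after rho g h n) phi <= dp_iter phi h + e%:E.
Proof.
elim: n phi e => [|n IH] phi e imU lphi e0.
  exists (fun s => UnivMFun
    (@measurable_fun_universally R _ _ _ _ (fun=> point) (measurable_cst point))).
  rewrite (_ : integral_completed _ _ = phi h); first by rewrite leeDl// lee_fin ltW.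
  exact: integral_completed_dirac.
have e20 : (0 < e / 2)%R by rewrite divr_gt0.
have imUn : baire_image (U (n + t)%N) by exact: imU.
have [|g Hg] := IH (dp_step phi) _ _ (baire_lsa_dp_step imUn lphi) e20.
  by move=> k kn; apply: imU; exact: leqW.
have [gn Hgn] := step_value_upper_bound (rho (n + t)) (law_after rho g h n) lphi imUn e20.
exists (update_policy g gn) => /=.
(* Changing the policy at the last time leaves the law of the earlier steps unchanged. *)
rewrite update_policy_same (@eq_law_after _ g) => [|k kn]; last first.
  by apply: update_policy_other => /eqP; rewrite eqn_add2r ltn_eqF.
apply: le_trans Hgn _.
by rewrite [in leRHS](splitr e) EFinD addeA leeD2r.
Qed.

Lemma hist_cast_id t (e : t = t) (h : hist U W t) : hist_cast e h = h.
Proof. by rewrite (eq_axiomK e). Qed.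

Lemma baire_lsa_cast s t (e : s = t) (phi : hist U W t -> \bar R) :
  baire_lsa phi -> baire_lsa (phi \o hist_cast e).
Proof. by case: t / e phi. Qed.

Lemma dp_step_cast s t (e : s = t) (e' : s.+1 = t.+1) (phi : hist U W t.+1 -> \bar R) :
  dp_step phi \o hist_cast e = dp_step (phi \o hist_cast e').
Proof.
case: t / e e' phi => e' phi.
have -> : phi \o hist_cast e' = phi by apply/funext => h /=; rewrite hist_cast_id.
by [].
Qed.

(** [dp_iter] recurses on the last step; this is the recursion on the first one, with a cast because
    the two sums are not convertible. *)
Lemma dp_iterS t n (e : (n + t.+1 = n.+1 + t)%N) (phi : hist U W (n.+1 + t) -> \bar R) :
  dp_iter phi = dp_step (dp_iter (phi \o hist_cast e)).
Proof.
elim: n e phi => [|n IH] e phi.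
  have -> : phi \o hist_cast e = phi by apply/funext => h /=; rewrite hist_cast_id.
  by [].
have e' : (n + t.+1 = n.+1 + t)%N by rewrite addnS addSn.
rewrite -[LHS]/(dp_iter (n := n.+1) (dp_step phi)) (IH e') /=.
by rewrite (dp_step_cast e' e).
Qed.

Section value.
Context (T : nat) (j : hist U W T -> \bar R).

Definition dp_value t (le_tT : (t <= T)%N) : hist U W t -> \bar R :=
  dp_iter (j \o hist_cast (subnK le_tT)).

Lemma dp_value_step t (le_tT : (t <= T)%N) (lt_tT : (t < T)%N) :
  dp_value le_tT = dp_step (dp_value lt_tT).
Proof.
rewrite /dp_value; move: (subnSK lt_tT) (subnK le_tT) (subnK lt_tT).
move: (T - t)%N (T - t.+1)%N => n m nm; case: n / nm => e.
by case: T / e j => j' e'; exact: dp_iterS.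
Qed.

Lemma dp_value_cast s t (e : s = t) (le_sT : (s <= T)%N) (le_tT : (t <= T)%N) :
  dp_value le_tT \o hist_cast e = dp_value le_sT.
Proof.
by case: t / e le_tT => le_tT; rewrite (bool_irrelevance le_tT le_sT).
Qed.

Lemma dp_value_iter t n (le_tT : (t <= T)%N) (le_ntT : (n + t <= T)%N) :
  dp_value le_tT = dp_iter (dp_value le_ntT).
Proof.
elim: n le_ntT => [|n IH] le_ntT; first by rewrite (bool_irrelevance le_tT le_ntT).
have le_nT : (n + t <= T)%N by exact: ltnW.
by rewrite (IH le_nT) (dp_value_step le_nT le_ntT).
Qed.

Hypotheses (imU : forall t, (t < T)%N -> baire_image (U t)) (lj : baire_lsa j).

(** Every policy costs at least the iterated value, and some policy comes within any eps of it. *)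
Lemma valueE t (le_tT : (t <= T)%N) : value rho j le_tT = dp_value le_tT.
Proof.
apply/funext => h; rewrite /value; case: eqP => [e|_].
  have n0 : (0 = T - t)%N by rewrite -e subnn.
  rewrite /dp_value; move: (subnK le_tT); case: (T - t)%N / n0 => e'.
  by rewrite /= (eq_irrelevance e' e).
rewrite /dp_value /history_law; move: (subnK le_tT) => e.
have lje := baire_lsa_cast e lj.
have imUe k : (k < T - t)%N -> baire_image (U (k + t)%N).
  by move=> kt; apply: imU; rewrite addnC -ltn_subRL.
have cast_law s (es : s = T) (mu : probability (hist U W s) R) :
    integral_completed (ecast k (probability (hist U W k) R) es mu) j =
    integral_completed mu (j \o hist_cast es).
  by case: T / es j.
apply/eqP; rewrite eq_le; apply/andP; split.
  apply/lee_addgt0Pr => eps eps0.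
  have [g Hg] := dp_iter_upper_bound h imUe lje eps0.
  apply: le_trans Hg; rewrite -cast_law; apply: ereal_inf_lbound.
  by exists g.
apply: le_ereal_inf_tmp => _ [g _ <-]; rewrite cast_law.
exact: dp_iter_lower_bound.
Qed.

Lemma baire_lsa_dp_value t (le_tT : (t <= T)%N) : baire_lsa (dp_value le_tT).
Proof.
elim: (T - t)%N {-2}t (erefl (T - t)%N) le_tT => [|n IH] {}t nE le_tT.
  have tT : t = T by apply/eqP; rewrite eqn_leq le_tT -subn_eq0 nE.
  have := baire_lsa_cast tT lj; congr (baire_lsa _).
  rewrite /dp_value; move: (subnK le_tT); rewrite nE => e'.
  by rewrite /= (eq_irrelevance e' tT).
have lt_tT : (t < T)%N by rewrite -subn_gt0 nE.
rewrite (dp_value_step le_tT lt_tT); apply: baire_lsa_dp_step; first exact: imU.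
by apply: IH; rewrite subnS nE.
Qed.

End value.

(** * Reduction over one block and conclusion *)

Section block.
Context (r : nat) (d : measure_display) (X : measurableType d)
  (rhot : forall k, R.-pker (X * steps U W r k) ~> W (k + r).+1).

(** Both iterations peel off the last step. Along the extensions of the fixed history h, the
    integrands coincide and the kernels agree on measurable sets, hence so do the completed
    integrals. *)
Lemma bellman_iter_dp n (h : hist U W r) (x : X)
    (phi : hist U W (n + r) -> \bar R) (psi : X * steps U W r n -> \bar R) :
  (forall k, (k < n)%N -> baire_image (U (k + r)%N)) -> baire_lsa phi ->
  (forall k, (k < n)%N -> forall (b : steps U W r k) A, measurable A ->
     rho (k + r)%N (hist_cat h b) A = rhot k (x, b) A) ->
  (forall b, psi (x, b) = phi (hist_cat h b)) ->
  bellman_iter rhot psi x = dp_iter phi h.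
Proof.
elim: n phi psi => [|n IH] phi psi imU lphi compat psiphi.
  by rewrite /= psiphi.
apply: IH => [k kn||k kn|b].
- by apply: imU; exact: leqW.
- by apply: baire_lsa_dp_step => //; exact: imU.
- by apply: compat; exact: leqW.
rewrite /bellman_step /dp_step /step_value; congr ereal_inf.
apply: eq_imagel => u _; rewrite /step_cost /=.
have -> : (fun w => psi (x, (b, (u, w)))) = (fun w => phi (hist_cat h b, (u, w))).
  by apply/funext => w; exact: psiphi.
apply: (integral_completed_eq _ (P := kernel_probability (rhot n) (x, b))
  (Q := kernel_probability (rho (n + r)) (hist_cat h b))).
  apply: (baire_lsa_comp _ lphi).
  apply: (@measurable_fun_pair _ _ _ (W (n + r).+1) (hist U W (n + r))
    (U (n + r) * W (n + r).+1)%type (fun=> hist_cat h b) (fun w => (u, w))) => //.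
  by apply: (@measurable_fun_pair _ _ _ (W (n + r).+1) (U (n + r)) (W (n + r).+1) (fun=> u) id).
by move=> A mA; apply: esym; exact: compat.
Qed.

End block.

End dynamic_programming.

(** Separation passes directly to finite products, which spares embedding history spaces into Polish
    spaces. *)
Lemma hist_separated (dU dW : nat -> measure_display)
    (U : forall t, measurableType (dU t)) (W : forall t, measurableType (dW t)) t :
  (forall s, (s < t)%N -> measurably_separated (U s)) ->
  (forall s, (s <= t)%N -> measurably_separated (W s)) ->
  measurably_separated (hist U W t).
Proof.
elim: t => [|t IH] sU sW; first exact: sW.
apply: measurably_separatedX; last first.
  by apply: measurably_separatedX; [exact: sU|exact: sW].
by apply: IH => s st; [exact/sU/leqW|exact/sW/leqW].
Qed.

Theorem theorem7 (R : realType) (dU dW dX : nat -> measure_display)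
  (U : forall t, measurableType (dU t)) (W : forall t, measurableType (dW t))
  (T : nat)
  (borelU : forall t, (t < T)%N -> borel_space R (U t))
  (borelW : forall t, (t <= T)%N -> borel_space R (W t))
  (rho : forall s, R.-pker (hist U W s) ~> W s.+1)
  (j : hist U W T -> \bar R) (lsaj : lower_semianalytic j)
  (N : nat) (N_ge1 : (1 <= N)%N)
  (t_ : nat -> nat) (t0 : t_ 0%N = 0%N) (tN : t_ N = T)
  (t_lt : forall i, (i < N)%N -> (t_ i < t_ i.+1)%N)
  (X : forall i, measurableType (dX i))
  (borelX : forall i, (i <= N)%N -> borel_space R (X i))
  (theta : forall i, hist U W (t_ i) -> X i)
  (f : forall i, X i * steps U W (t_ i) (t_ i.+1 - t_ i) -> X i.+1)
  (reduction : is_state_reduction N theta f)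
  (rhot : forall i k, R.-pker (X i * steps U W (t_ i) k) ~> W (k + t_ i).+1)
  (compat : compatible N theta rho rhot)
  (jt : X N -> \bar R) (lsajt : lower_semianalytic jt)
  (j_factor : forall h : hist U W (t_ N), j (hist_cast tN h) = jt (theta N h))
  (Vt : forall i, X i -> \bar R)
  (VtN : Vt N = jt)
  (Vt_rec : forall i, (i < N)%N ->
     Vt i = reduced_bellman (rhot i) (f i) (Vt i.+1)) :
  forall i, (i <= N)%N -> forall le_tT : (t_ i <= T)%N,
    value rho j le_tT = Vt i \o theta i.
Proof.
have imU t : (t < T)%N -> baire_image (U t).
  by move=> /borelU; exact: borel_space_baire_image.
have lj : baire_lsa j.
  apply: lower_semianalytic_baire lsaj; apply: hist_separated => s sT.
    exact: borel_space_separated (borelU _ sT).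
  exact: borel_space_separated (borelW _ sT).
have [_ _ red] := reduction.
(* Backward induction on the block index, written N - k, for the iterated value that [valueE]
   identifies with the value function. *)
suff main k : (k <= N)%N -> forall le_tT : (t_ (N - k)%N <= T)%N,
    dp_value rho j le_tT = Vt (N - k)%N \o theta (N - k)%N.
  by move=> i iN le_tT; rewrite valueE//; move: (main (N - i)%N (leq_subr _ _)); rewrite subKn.
elim: k => [|k IH] kN.
  rewrite subn0 => le_tT; rewrite VtN; apply/funext => h /=; rewrite -j_factor.
  rewrite /dp_value; move: (subnK le_tT).
  have n0 : (0 = T - t_ N)%N by rewrite tN subnn.
  by case: (T - t_ N)%N / n0 => e; rewrite /= (eq_irrelevance e tN).
have iN : (N - k.+1 < N)%N by rewrite ltn_subrL; exact: leq_trans kN.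
move: (IH (ltnW kN)); rewrite -(subnSK kN); move: (N - k.+1)%N iN => i iN {}IH le_tT.
have le_t : (t_ i <= t_ i.+1)%N by exact/ltnW/t_lt.
have le_TN : (t_ i.+1 <= T)%N.
  have t_le m : (i.+1 + m <= N)%N -> (t_ i.+1 <= t_ (i.+1 + m))%N.
    elim: m => [|m IHm] mN; first by rewrite addn0.
    rewrite addnS in mN *.
    exact: leq_trans (IHm (ltnW mN)) (ltnW (t_lt _ mN)).
  by rewrite -tN -(subnKC iN); apply: t_le; rewrite subnKC.
have imU' m : (m < t_ i.+1 - t_ i)%N -> baire_image (U (m + t_ i)%N).
  move=> mt; apply: imU; apply: leq_trans le_TN; by rewrite addnC -ltn_subRL.
apply/funext => h /=; rewrite Vt_rec// /reduced_bellman.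
have lv := baire_lsa_dp_value rho imU lj le_TN.
(* The state reduction turns the induction hypothesis at the end of the block into [Vt i.+1]
   composed with [f i], as a function of the steps appended to h. *)
rewrite (@bellman_iter_dp _ _ _ _ _ rho _ _ _ _ _ h _
  (dp_value rho j le_TN \o hist_cast (subnK le_t))).
- have le_ntT : (t_ i.+1 - t_ i + t_ i <= T)%N by rewrite subnK.
  by rewrite (dp_value_cast rho j _ le_ntT) (dp_value_iter rho j le_tT le_ntT).
- exact: imU'.
- exact: baire_lsa_cast.
- by move=> m mt b A mA; exact: compat.
- by move=> b /=; rewrite IH /= -(red i iN le_t).
Qed.
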